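(* Let $q\geq 0$ be any integer and let $U\subset\mathbb{C}^n$ be a non-empty open set. An upper semi-continuous function $u:U\to[-\infty,\infty)$ is $q$-plurisubharmonic on $U$ if and only if it is $q$-plurisubharmonic in the viscosity sense on $U$.
   Context: Definitions. Let $U\subset\mathbb{C}^n$ be open and $u:U\to[-\infty,\infty)$ upper semi-continuous. (i) $u$ is subpluriharmonic on $U$ if either $u\equiv-\infty$ on $U$, or for every compact ball $\overline{B}\subset U$ and every continuous plurisubharmonic function $h$ defined in a neighborhood of $\overline{B}$, the restriction of $u+h$ to $\overline{B}$ attains its maximum on the boundary $bB$, i.e. $\max_{\overline{B}}(u+h)=\max_{bB}(u+h)$. (ii) For an integer $0\leq q<n$, $u$ is $q$-plurisubharmonic on $U$ if it is subpluriharmonic on $U\cap\pi$ for every $(q+1)$-dimensional complex affine subspace $\pi$ of $\mathbb{C}^n$ (where $\pi$ is identified with $\mathbb{C}^{q+1}$). For integers $q\geq n$, by convention every upper semi-continuous function is $q$-plurisubharmonic. (iii) For a real-valued $\mathcal{C}^2$ function $\varphi$, its complex Hessian is the Hermitian matrix $H^{\mathbb{C}}\varphi=\left[\frac{\partial^2\varphi}{\partial z_k\partial\overline{z_\ell}}\right]_{k,\ell=1,\ldots,n}$. For a Hermitian matrix $\mathcal{A}$, $\ominus(\mathcal{A})$ denotes the number of strictly negative eigenvalues of $\mathcal{A}$ (counted with multiplicity). (iv) For an integer $q\geq 0$, $u$ is $q$-plurisubharmonic in the viscosity sense on $U$ if either $u\equiv-\infty$ on $U$, or for every real-valued $\varphi\in\mathcal{C}^2(U)$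 one has $\ominus(H^{\mathbb{C}}\varphi(\hat{p}))\leq q$ at every point $\hat{p}\in U$ where $u-\varphi$ attains its maximum over $U$. *)

(* Defs.v *)
From HB Require Import structures.
From mathcomp Require Import all_boot all_order all_algebra.
From mathcomp Require Import complex.
From mathcomp Require Import all_classical all_reals all_analysis.

Set Implicit Arguments.
Unset Strict Implicit.
Unset Printing Implicit Defensive.

Import Order.TTheory GRing.Theory Num.Theory.
Import numFieldNormedType.Exports.

Local Open Scope classical_set_scope.
Local Open Scope ring_scope.
Local Open Scope complex_scope.

(* real-closed gives [R[i]] its field structure and modulus but no topology;
   this is the topology of the modulus. The space C^n is ['rV[R[i]]_n]; the
   library norm on it is the maximum norm, which induces the usual topology,
   but the compact balls below are Euclidean. *)
#[warnings="-redundant-canonical-projection"]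
HB.instance Definition _ (R : rcfType) := NormedModule.copy R[i] (R[i])^o.

Section Cn.
Context {R : realType}.
Local Notation C := R[i].

Definition eucl_norm n (z : 'rV[C]_n) : R :=
  Num.sqrt (\sum_(k < n) (complex.Re (z 0 k) ^+ 2 + complex.Im (z 0 k) ^+ 2)).

Definition closed_eball n (c : 'rV[C]_n) (r : R) : set 'rV[C]_n :=
  [set z | eucl_norm (z - c) <= r].

Definition esphere n (c : 'rV[C]_n) (r : R) : set 'rV[C]_n :=
  [set z | eucl_norm (z - c) = r].

(* Functions on a subset [U] of C^n with values in [-oo, +oo[ are total
   functions to [\bar R]; only their values on [U] are ever used. *)
Definition usc_on n (U : set 'rV[C]_n) (u : 'rV[C]_n -> \bar R) :=
  forall z, U z ->
    (u z < +oo)%E /\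
    forall a : R, (u z < a%:E)%E ->
      \forall w \near within U (nbhs z), (u w < a%:E)%E.

Definition expi (t : R) : C := cos t +i* sin t.

Definition plurisubharmonic n (V : set 'rV[C]_n) (h : 'rV[C]_n -> \bar R) :=
  usc_on V h /\
  forall a b : 'rV[C]_n,
    (forall x : C, `|x| <= 1 -> V (a + x *: b)) ->
    (h a <= ((2 * pi)^-1)%:E *
      \int[lebesgue_measure]_(t in `[0%R, (2 * pi)%R]) h (a + expi t *: b)%R)%E.

Definition subpluriharmonic n (U : set 'rV[C]_n) (u : 'rV[C]_n -> \bar R) :=
  (forall z, U z -> u z = -oo%E) \/
  forall (c : 'rV[C]_n) (r : R), 0 < r -> closed_eball c r `<=` U ->
  forall (V : set 'rV[C]_n) (h : 'rV[C]_n -> R),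
    open V -> closed_eball c r `<=` V ->
    (forall z, V z -> {for z, continuous h}) ->
    plurisubharmonic V (EFin \o h) ->
    exists2 z, esphere c r z &
      forall w, closed_eball c r w ->
        (u w + (h w)%:E <= u z + (h z)%:E)%E.

(* [unitarymx] for a rectangular matrix says that its rows are orthonormal, so
   [w |-> a + w *m A] identifies C^(q+1) isometrically with the complex affine
   subspace of dimension q + 1 through [a] directed by the rows of [A]; every
   such subspace arises this way. Upper semicontinuity of [u], the only
   condition when n <= q, is a standing assumption on [u]. *)
Definition qpsh (q n : nat) (U : set 'rV[C]_n) (u : 'rV[C]_n -> \bar R) :=
  (q < n)%N ->
  forall (a : 'rV[C]_n) (A : 'M[C]_(q.+1, n)), A \is unitarymx ->
    subpluriharmonic [set w : 'rV[C]_q.+1 | U (a + w *m A)]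
                     (fun w => u (a + w *m A)).

(* Derivatives along the real line z + R v, the scalar t being real. *)
Definition rderivable n (v : 'rV[C]_n) (f : 'rV[C]_n -> R) (z : 'rV[C]_n) :=
  derivable (fun t : R => f (z + t%:C *: v)) 0 1.

Definition rderiv n (v : 'rV[C]_n) (f : 'rV[C]_n -> R) (z : 'rV[C]_n) : R :=
  derive1 (fun t : R => f (z + t%:C *: v)) 0.

(* With z_k = x_k + i y_k, these are the directions of x_k and y_k. *)
Definition dirx n (k : 'I_n) : 'rV[C]_n := delta_mx 0 k.
Definition diry n (k : 'I_n) : 'rV[C]_n := (0 +i* 1) *: delta_mx 0 k.

Fixpoint Ck (m : nat) n (U : set 'rV[C]_n) (f : 'rV[C]_n -> R) : Prop :=
  (forall z, U z -> {for z, continuous f}) /\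
  if m is m'.+1 then
    forall k : 'I_n,
      [/\ forall z, U z -> rderivable (dirx k) f z,
          forall z, U z -> rderivable (diry k) f z,
          Ck m' U (rderiv (dirx k) f)
        & Ck m' U (rderiv (diry k) f)]
  else True.

(* Real directional derivative of a complex-valued function. *)
Definition rderivC n (v : 'rV[C]_n) (f : 'rV[C]_n -> C) (z : 'rV[C]_n) : C :=
  rderiv v (fun w => complex.Re (f w)) z +i* rderiv v (fun w => complex.Im (f w)) z.

(* Wirtinger derivatives d/dz_k and d/dzbar_k. *)
Definition dz n (k : 'I_n) (f : 'rV[C]_n -> C) (z : 'rV[C]_n) : C :=
  2^-1 * (rderivC (dirx k) f z - (0 +i* 1) * rderivC (diry k) f z).

Definition dzbar n (k : 'I_n) (f : 'rV[C]_n -> C) (z : 'rV[C]_n) : C :=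
  2^-1 * (rderivC (dirx k) f z + (0 +i* 1) * rderivC (diry k) f z).

Definition complex_hessian n (phi : 'rV[C]_n -> R) (z : 'rV[C]_n) : 'M[C]_n :=
  \matrix_(k < n, l < n) dz k (dzbar l (fun w => (phi w)%:C)) z.

Definition eigenvalues n (A : 'M[C]_n) : seq C :=
  sval (closed_field_poly_normal (char_poly A)).

(* In [R[i]], [x < 0] means that x is real and negative. *)
Definition ominus n (A : 'M[C]_n) : nat := count (fun x => x < 0) (eigenvalues A).

Definition viscosity_qpsh (q n : nat) (U : set 'rV[C]_n)
    (u : 'rV[C]_n -> \bar R) :=
  (forall z, U z -> u z = -oo%E) \/
  forall phi : 'rV[C]_n -> R, Ck 2 U phi ->
  forall p, U p ->
    (forall z, U z -> (u z - (phi z)%:E <= u p - (phi p)%:E)%E) ->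
    (ominus (complex_hessian phi p) <= q)%N.

End Cn.

(* Main.v *)
Require Import Defs.
From mathcomp Require Import all_boot all_order all_algebra.
From mathcomp Require Import complex.
From mathcomp Require Import all_classical all_reals all_analysis.
From mathcomp Require Import ring lra.
Set Implicit Arguments.
Unset Strict Implicit.
Unset Printing Implicit Defensive.
Import Order.TTheory GRing.Theory Num.Theory.
Import numFieldNormedType.Exports.

Local Open Scope classical_set_scope.
Local Open Scope ring_scope.
Local Open Scope complex_scope.
Local Open Scope sesquilinear_scope.

(** Let L be the Levi form of a C^2 function at a point, that is, the Hermitian
form of its complex Hessian, and let D be the real second derivative there, as a
quadratic form. Then 4 L(b) = D(b) + D(ib) [herm_form_levi], and the mean of a
real quadratic polynomial over the circle of the points a + e^(it) b exceeds its
value at a by exactly L(b) [mean_quad_circle]. By the spectral theorem, the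
complex Hessian has more than q negative eigenvalues if and only if L is negative
definite on some complex subspace of dimension q + 1 [ominus_gt_subspace,
ominus_gt_of_negative].

From q-plurisubharmonic to viscosity [qpsh_viscosity]. Let u - phi be maximal at p
and suppose that L, for phi at p, is negative definite on a subspace of dimension
q + 1. On the slice through p in the direction of that subspace, let h be the
opposite of the second order Taylor polynomial of phi, up to a constant, minus
c |w|^2 for a small c > 0. Its Levi form is nonnegative, so h is plurisubharmonic; but u <= phi + const
and Taylor's formula make u + h smaller on every small sphere around p than at p.

From viscosity to q-plurisubharmonic [viscosity_qpsh_qpsh]. Suppose that on some
slice u + h is larger at some point of a ball than on its sphere. Adding
eps |w - c|^2 to h keeps this and makes h strictly plurisubharmonic. Let H be the
pull-back of h by the orthogonal projection to the slice, minus K times the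
distance to the slice. For large K, the maximum of u + H over a thin tube around
the ball is not reached on the boundary of the tube. As h is only continuous, H
has to be smoothed. The smoothing G is obtained by averaging over short segments,
twice in each real coordinate direction: the average of f over a segment from z to
z + d v is differentiable along v with derivative (f(z + d v) - f(z)) / d, so two
averages per direction give a C^2 function [Ck_boxes]. Averages along different
curves commute [average_comm], hence the strict sub-mean value inequality of H over
circles in the slice direction holds for G too [smooth_submean], and then the Levi
form of G is positive in these directions [levi_of_submean]. Now u + G has a local
maximum at some point p of the tube [smooth_tube_max]. There is a C^2 function
F >= 0 on the open set which vanishes near p and is so large elsewhere that
u + G - F is maximal at p over the whole open set [domination]. So phi = F - G is a
test function at p, and its Levi form is negative on q + 1 dimensions, against the
viscosity condition [viscosity_touching]. *)

(** * Real coordinates of C^n *)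

Section Coordinates.
Context {R : realType} {n : nat}.
Local Notation C := R[i].
Implicit Types (z w b : 'rV[C]_n) (j : 'I_n * bool) (t : R).

Definition rcoord j z : R :=
  if j.2 then complex.Im (z 0 j.1) else complex.Re (z 0 j.1).

Definition cdir j : 'rV[C]_n := if j.2 then diry j.1 else dirx j.1.

(** This norm is used for all estimates: it takes real values, whereas the norm
of a row vector over R[i] lies in R[i], and it is additive along the coordinate
directions, which suits telescoping sums and iterated averages. *)
Definition norm1 z : R := \sum_j `|rcoord j z|.

Lemma rcoordD j z w : rcoord j (z + w) = rcoord j z + rcoord j w.
Proof. by rewrite /rcoord mxE; case: j.2; case: (z 0 _) (w 0 _) => ? ? []. Qed.

Lemma rcoordN j z : rcoord j (- z) = - rcoord j z.
Proof. by rewrite /rcoord mxE; case: j.2; case: (z 0 _). Qed.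

Lemma rcoordB j z w : rcoord j (z - w) = rcoord j z - rcoord j w.
Proof. by rewrite rcoordD rcoordN. Qed.

Lemma rcoord0 j : rcoord j 0 = 0.
Proof. by rewrite /rcoord mxE; case: j.2. Qed.

Lemma rcoordZ j t z : rcoord j (t%:C *: z) = t * rcoord j z.
Proof.
by rewrite /rcoord mxE; case: j.2; case: (z 0 _) => x y /=; rewrite mul0r ?subr0 ?addr0.
Qed.

Lemma rcoord_sum (I : Type) (r : seq I) (P : pred I) (F : I -> 'rV[C]_n) j :
  rcoord j (\sum_(i <- r | P i) F i) = \sum_(i <- r | P i) rcoord j (F i).
Proof. exact: (big_morph _ (rcoordD j) (rcoord0 j)). Qed.

Lemma rcoord_inj z w : (forall j, rcoord j z = rcoord j w) -> z = w.
Proof.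
move=> zw; apply/rowP => k; apply/eqP; rewrite eq_complex.
by apply/andP; split; apply/eqP; [exact: (zw (k, false)) | exact: (zw (k, true))].
Qed.

Lemma rcoord_cdir i j : rcoord i (cdir j) = (i == j)%:R.
Proof.
case: i j => i [] [j []]; rewrite /rcoord /cdir /dirx /diry /= !mxE xpair_eqE eqxx ?andbT ?andbF /=;
  case: eqP => //= _; rewrite ?mulr0n ?mulr1n /= ; lra.
Qed.

Lemma rcoordE z : z = \sum_j (rcoord j z)%:C *: cdir j.
Proof.
apply: rcoord_inj => i; rewrite rcoord_sum (bigD1 i) //= big1 ?addr0 => [|j ij].
  by rewrite rcoordZ rcoord_cdir eqxx mulr1.
by rewrite rcoordZ rcoord_cdir eq_sym (negbTE ij) mulr0.
Qed.

Lemma norm1_ge0 z : 0 <= norm1 z.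
Proof. exact: sumr_ge0. Qed.

Lemma norm1D z w : norm1 (z + w) <= norm1 z + norm1 w.
Proof.
by rewrite /norm1 -big_split; apply: ler_sum => j _; rewrite rcoordD ler_normD.
Qed.

Lemma norm1N z : norm1 (- z) = norm1 z.
Proof. by apply: eq_bigr => j _; rewrite rcoordN normrN. Qed.

Lemma norm1_distC z w : norm1 (z - w) = norm1 (w - z).
Proof. by rewrite -norm1N opprB. Qed.

Lemma norm1_triangle w z x : norm1 (z - x) <= norm1 (z - w) + norm1 (w - x).
Proof. by apply: le_trans (norm1D _ _); rewrite addrA subrK. Qed.

Lemma norm10 : norm1 0 = 0.
Proof. by rewrite /norm1 big1 // => j _; rewrite rcoord0 normr0. Qed.

Lemma norm1Z t z : norm1 (t%:C *: z) = `|t| * norm1 z.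
Proof.
by rewrite /norm1 big_distrr; apply: eq_bigr => j _; rewrite rcoordZ normrM.
Qed.

Lemma norm1_cdir j : norm1 (cdir j) = 1.
Proof.
rewrite /norm1 (bigD1 j) //= big1 => [|i /negbTE ij].
  by rewrite rcoord_cdir eqxx normr1 addr0.
by rewrite rcoord_cdir ij normr0.
Qed.

Lemma le_rcoord_norm1 j z : `|rcoord j z| <= norm1 z.
Proof. by rewrite /norm1 (bigD1 j) //= lerDl sumr_ge0. Qed.

Lemma norm1_sum (I : Type) (r : seq I) (P : pred I) (F : I -> 'rV[C]_n) :
  norm1 (\sum_(i <- r | P i) F i) <= \sum_(i <- r | P i) norm1 (F i).
Proof.
elim/big_rec2: _ => [|i y x _ xy]; first by rewrite norm10.
by apply: le_trans (norm1D _ _) _; rewrite lerD2l.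
Qed.

Lemma norm1_eq0 z : norm1 z = 0 -> z = 0.
Proof.
move=> z0; apply: rcoord_inj => j; rewrite rcoord0; apply/eqP; rewrite -normr_eq0.
by rewrite eq_le normr_ge0 andbT -z0 le_rcoord_norm1.
Qed.

Lemma eucl_norm_rcoord z : eucl_norm z ^+ 2 = \sum_j rcoord j z ^+ 2.
Proof.
rewrite /eucl_norm sqr_sqrtr; last by apply: sumr_ge0 => k _; rewrite addr_ge0 ?sqr_ge0.
rewrite -(pair_bigA _ (fun (k : 'I_n) (c : bool) => rcoord (k, c) z ^+ 2)) /=.
by apply: eq_bigr => k _; rewrite big_bool /= addrC.
Qed.

Lemma eucl_norm_ge0 z : 0 <= eucl_norm z.
Proof. exact: sqrtr_ge0. Qed.

Lemma le_rcoord_eucl j z : `|rcoord j z| <= eucl_norm z.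
Proof.
rewrite -ler_sqr ?nnegrE ?normr_ge0 ?eucl_norm_ge0 // eucl_norm_rcoord real_normK ?num_real //.
by rewrite (bigD1 j) //= lerDl sumr_ge0 // => i _; exact: sqr_ge0.
Qed.

Lemma norm1_le_eucl z : norm1 z <= (n * 2)%:R * eucl_norm z.
Proof.
apply: le_trans (_ : \sum_(j : 'I_n * bool) eucl_norm z <= _).
  by apply: ler_sum => j _; exact: le_rcoord_eucl.
by rewrite sumr_const card_prod card_ord card_bool mulr_natl.
Qed.

Lemma eucl_le_norm1 z : eucl_norm z <= norm1 z.
Proof.
rewrite -ler_sqr ?nnegrE ?norm1_ge0 ?eucl_norm_ge0 // eucl_norm_rcoord expr2.
rewrite {1}/norm1 mulr_suml; apply: ler_sum => j _.
rewrite -[_ ^+ 2]real_normK ?num_real // expr2.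
by apply: ler_wpM2l => //; exact: le_rcoord_norm1.
Qed.

(** The bridge to the topology of the matrix space, whose balls have radii in
R[i]; a positive element of R[i] is real. *)
Lemma nbhs_norm1P z (P : set 'rV[C]_n) :
  nbhs z P <-> exists2 d : R, 0 < d & forall w, norm1 (w - z) < d -> P w.
Proof.
split=> [/nbhs_ballP [e /= e0 eP]|[d d0 dP]].
  have eE : e = (complex.Re e)%:C.
    by move: e0; case: (e) => a b; rewrite ltcE /= => /andP[/eqP -> _].
  have r0 : 0 < complex.Re e by rewrite -(ltcR 0) -eE.
  exists (complex.Re e) => // w wz; apply: eP; split => // i k.
  rewrite (ord1 i) {i}.
  rewrite -ball_normE /ball_ /= eE; case zwk: (z 0 k - w 0 k) => [x y].
  rewrite normc_def ltcR /=.
  apply: le_lt_trans wz.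
  rewrite norm1_distC; apply: le_trans (eucl_le_norm1 _).
  rewrite /eucl_norm ler_wsqrtr // (bigD1 k) //= !mxE zwk /= lerDl.
  by apply: sumr_ge0 => ? _; rewrite addr_ge0 ?sqr_ge0.
apply/nbhs_ballP; exists (d / (n * 2).+1%:R)%:C => /=.
  by rewrite (ltcR 0) divr_gt0.
move=> w [_ zw]; apply: dP.
apply: le_lt_trans (_ : \sum_(j : 'I_n * bool) (d / (n * 2).+1%:R) < _); last first.
  rewrite sumr_const card_prod card_ord card_bool -[_ *+ _]mulr_natr mulrAC.
  by rewrite ltr_pdivrMr ?ltr0n // ltr_pM2l // ltr_nat.
apply: ler_sum => -[k b] _.
have := zw 0 k; rewrite -ball_normE /ball_ /=.
case zwk: (z 0 k - w 0 k) => [x y]; rewrite normc_def ltcR /= => /ltW.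
apply: le_trans.
rewrite -normrN -rcoordN opprB /rcoord /= !mxE zwk /= -sqrtr_sqr ler_wsqrtr //.
by case: b; rewrite ?lerDl ?lerDr sqr_ge0.
Qed.

End Coordinates.

(** * Compactness and upper semicontinuity *)
Section Topology.
Context {R : realType} {n : nat}.
Local Notation C := R[i].
Local Notation V := 'rV[C]_n.
Implicit Types (z w b : V) (K U : set V) (f : V -> R).

Lemma open_norm1P U :
  open U <-> forall z, U z -> exists2 d : R, 0 < d & forall w, norm1 (w - z) < d -> U w.
Proof.
by rewrite openE; split=> UP z Uz; apply/nbhs_norm1P; exact: UP.
Qed.

Lemma continuous_norm1P f z :
  {for z, continuous f} <-> forall e : R, 0 < e ->
    exists2 d : R, 0 < d & forall w, norm1 (w - z) < d -> `|f w - f z| < e.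
Proof.
split=> [fz e e0|fz].
  have fz' : f @ nbhs z --> f z by exact: fz.
  have /nbhs_norm1P [d d0 dP] := (@cvgr_dist_lt _ _ _ _ (nbhs_filter z) _ _ fz' e e0).
  by exists d => // w /dP; rewrite distrC.
apply: (iffRL (@cvgrPdist_lt _ _ _ _ (nbhs_filter z) _ _)) => e e0; apply/nbhs_norm1P.
by have [d d0 dP] := fz e e0; exists d => // w /dP; rewrite distrC.
Qed.

(** A product of squares of C is compact, being a product of images of compact
rectangles of the real plane. *)
Lemma compact_norm1 K (M : R) :
  (forall z, K z -> norm1 z <= M) ->
  (forall z, ~ K z -> exists2 d : R, 0 < d & forall w, norm1 (w - z) < d -> ~ K w) ->
  compact K.
Proof.
move=> KM Kc.
pose Q : set C := (fun p : R * R => (p.1 +i* p.2)) @` (`[- M, M] `*` `[- M, M]).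
have cQ : compact Q.
  apply: continuous_compact; last first.
    by apply: compact_setX; exact: segment_compact.
  apply: continuous_subspaceT => p.
  apply/cvgrPdist_lt => /= e e0.
  have eE : e = (complex.Re e)%:C.
    by move: e0; case: (e) => a b; rewrite ltcE /= => /andP[/eqP -> _].
  have r0 : 0 < complex.Re e by rewrite -(ltcR 0) -eE.
  have r2 : 0 < complex.Re e / 2 by rewrite divr_gt0.
  exists (ball p.1 (complex.Re e / 2), ball p.2 (complex.Re e / 2)).
    by split; exact: nbhsx_ballx.
  move=> [a b] [] /=; rewrite /ball /= => pa pb.
  rewrite eE normc_def ltcR /=.
  apply: le_lt_trans (_ : `|p.1 - a| + `|p.2 - b| < _); last by rewrite [ltRHS]splitr ltrD.
  rewrite -ler_sqr ?nnegrE ?addr_ge0 ?sqrtr_ge0 // sqr_sqrtr ?addr_ge0 ?sqr_ge0 //.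
  have -> (x y : R) : (`|x| + `|y|) ^+ 2 = x ^+ 2 + y ^+ 2 + `|x| * `|y| *+ 2.
    by rewrite sqrrD !real_normK ?num_real // addrAC.
  by rewrite lerDl mulrn_wge0 // mulr_ge0.
have cQn : compact [set v : V | forall i, Q (v ord0 i)] by apply: (@rV_compact C n (fun=> Q)).
apply: subclosed_compact cQn _.
  rewrite -openC; apply/open_norm1P => z nKz.
  by have [d d0 dP] := Kc z nKz; exists d.
move=> v Kv i; exists (complex.Re (v 0 i), complex.Im (v 0 i)); last by case: (v _ _).
have le (c : bool) := le_trans (le_rcoord_norm1 (i, c) v) (KM v Kv).
by split; rewrite /= in_itv /= -ler_norml; [exact: (le false)|exact: (le true)].
Qed.

(** Compactness as uniformity of scale: if a property holds near each point of K
for all small e, then a single e serves for all of K. This is the near-covering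
property for the filter of small positive reals. *)
Lemma compact_uniform K (P : R -> V -> Prop) : compact K ->
  (forall x, K x -> exists2 d : R, 0 < d &
     forall e y, 0 < e < d -> K y -> norm1 (y - x) < d -> P e y) ->
  exists2 d : R, 0 < d & forall x, K x -> P d x.
Proof.
move=> /compact_near_coveringP/near_covering_withinP cK KP.
have : \forall e \near (0 : R)^'+, K `<=` P e.
  apply: cK => x /KP[d d0 dP].
  exists ([set y | norm1 (y - x) < d], [set e : R | 0 < e < d]) => /=.
    split; first by apply/nbhs_norm1P; exists d.
    near=> e; apply/andP; split; first by near: e; exact: nbhs_right_gt.
    by near: e; exact: nbhs_right_lt.
  by case=> y e /= [yx ed] Ky; exact: dP.
move=> H; near (0 : R)^'+ => e.
exists e; first by near: e; exact: nbhs_right_gt.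
by near: e.
Unshelve. all: by end_near. Qed.

Lemma compact_thickening K U : compact K -> open U -> K `<=` U ->
  exists2 d : R, 0 < d & forall x, K x -> forall w, norm1 (w - x) < d -> U w.
Proof.
move=> cK /open_norm1P oU KU.
apply: (compact_uniform (P := fun d x => forall w, norm1 (w - x) < d -> U w)) => //.
move=> x /KU/oU[d d0 dP]; exists (d / 2); first by rewrite divr_gt0.
move=> e y /andP[e0 ed] _ yx w wy; apply: dP.
apply: le_lt_trans (norm1_triangle y _ _) _.
by rewrite [ltRHS]splitr ltrD // (lt_trans wy).
Qed.

(** Uniform continuity is required over the whole space, so that averaging along
any curve preserves it with the same modulus. *)
Definition uc f := forall e : R, 0 < e ->
  exists2 d : R, 0 < d & forall z w, norm1 (w - z) <= d -> `|f w - f z| <= e.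

(** Heine-Cantor; two points that are both outside K need no estimate. *)
Lemma uc_compact_support K f : compact K -> (forall z, {for z, continuous f}) ->
  (forall z, ~ K z -> f z = 0) -> uc f.
Proof.
move=> cK cf f0 e e0.
have [d d0 dP] : exists2 d : R, 0 < d & forall x, K x ->
    forall w, norm1 (w - x) < d -> `|f w - f x| <= e.
  apply: (compact_uniform
    (P := fun d x => forall w, norm1 (w - x) < d -> `|f w - f x| <= e)) => // x _.
  have [|d d0 dP] := iffLR (continuous_norm1P f x) (cf x) (e / 2); first by rewrite divr_gt0.
  exists (d / 2); first by rewrite divr_gt0.
  move=> r y /andP[r0 rd] _ yx w wy.
  have yxd : norm1 (y - x) < d by apply: lt_trans yx _; rewrite gtr_pMr // invf_lt1 // ltr1n.
  have wxd : norm1 (w - x) < d.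
    apply: le_lt_trans (norm1_triangle y _ _) _.
    by rewrite [ltRHS]splitr ltrD // (lt_trans wy).
  apply: le_trans (ler_distD (f x) _ _) _.
  by rewrite [leRHS]splitr lerD // ltW // ?dP // distrC dP.
exists (d / 2); first by rewrite divr_gt0.
move=> z w wz.
have {}wz : norm1 (w - z) < d by apply: le_lt_trans wz _; rewrite gtr_pMr // invf_lt1 // ltr1n.
have [Kz|nKz] := pselect (K z); first exact: dP.
have [Kw|nKw] := pselect (K w); first by rewrite distrC; apply: dP; rewrite // norm1_distC.
by rewrite !f0 // subrr normr0 ltW.
Qed.

Lemma usc_norm1P U (u : V -> \bar R) z : usc_on U u -> U z ->
  (u z < +oo)%E /\ forall a : R, (u z < a%:E)%E ->
    exists2 d : R, 0 < d & forall w, U w -> norm1 (w - z) < d -> (u w < a%:E)%E.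
Proof.
move=> uU Uz; have [uoo ua] := uU z Uz; split => // a /ua.
rewrite /within /= => /nbhs_norm1P[d d0 dP].
by exists d => // w Uw wz; exact: dP.
Qed.

Lemma usc_onS U U' (u : V -> \bar R) : U' `<=` U -> usc_on U u -> usc_on U' u.
Proof.
move=> UU uU z U'z; have [uoo ua] := usc_norm1P uU (UU _ U'z); split => // a /ua[d d0 dP].
by apply/nbhs_norm1P; exists d => // w wz U'w; apply: dP => //; exact: UU.
Qed.

Lemma usc_onD U (u : V -> \bar R) f : usc_on U u ->
  (forall z, U z -> {for z, continuous f}) -> usc_on U (fun z => u z + (f z)%:E)%E.
Proof.
move=> uU cf z Uz; have [uoo ua] := usc_norm1P uU Uz.
split=> [|a]; first by case: (u z) uoo => [r| |] // _; rewrite ?ltry.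
rewrite -lteBrDr // -EFinB => ufa.
have [b ub ba] : exists2 b : R, (u z < b%:E)%E & b < a - f z.
  case: (u z) ufa uoo => [r| |] //.
    rewrite lte_fin => ra _; exists ((r + (a - f z)) / 2); last by rewrite midf_lt.
    by rewrite lte_fin midf_lt.
  by move=> _ _; exists (a - f z - 1); rewrite ?ltNye // gtrBl.
have [d1 d10 P1] := ua b ub.
have [|d2 d20 P2] := iffLR (continuous_norm1P f z) (cf z Uz) (a - f z - b); first by rewrite subr_gt0.
apply/nbhs_norm1P; exists (Order.min d1 d2); first by rewrite lt_min d10.
move=> w; rewrite lt_min => /andP[w1 w2] /= Uw.
have := P1 w Uw w1; have := P2 w w2; rewrite ltr_norml => /andP[_ fw] uw.
rewrite -lteBrDr // -EFinB; apply: lt_trans uw _; rewrite lte_fin; lra.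
Qed.

(** If the supremum M were not reached, the relatively open sets where u < i, for
i < M, would cover K, and u would stay below a single such i. *)
Lemma usc_max K (u : V -> \bar R) : compact K -> K !=set0 -> usc_on K u ->
  exists2 z, K z & forall w, K w -> (u w <= u z)%E.
Proof.
move=> /compact_near_coveringP/near_covering_withinP cK [z0 Kz0] uK.
pose M := ereal_sup (u @` K).
have uM w : K w -> (u w <= M)%E by move=> Kw; apply: ereal_sup_ubound; exists w.
have [[z [Kz zM]]|nM] := pselect (exists z, K z /\ (M <= u z)%E).
  by exists z => // w /uM /le_trans; apply.
have ltM z : K z -> (u z < M)%E.
  by move=> Kz; rewrite ltNge; apply/negP => zM; apply: nM; exists z.
pose F := filter_from [set i | (i < M)%E] (fun i => [set j | (i <= j)%E /\ (j < M)%E]).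
have FF : Filter F.
  apply: filter_from_filter; first by exists (u z0); exact: ltM.
  move=> i j /= iM jM; exists (Order.max i j); first by rewrite /= gt_max iM.
  by move=> k /= [+ kM]; rewrite ge_max => /andP[].
have : \near F, K `<=` (fun z => u z < F)%E.
  apply: cK => x Kx; have [xoo xa] := usc_norm1P uK Kx.
  have [a xa' aM] : exists2 a : R, (u x < a%:E)%E & (a%:E < M)%E.
    have := ltM x Kx; clear -xoo.
    case: (u x) xoo => [r| |] //; case: M => [m| |] //.
    - rewrite !lte_fin => _ rm; exists ((r + m) / 2); by rewrite lte_fin midf_lt.
    - by move=> _ _; exists (r + 1); rewrite ?lte_fin ?ltrDl ?ltry.
    - by move=> _ _; exists (m - 1); rewrite ?ltNyr ?lte_fin ?gtrBl.
    - by move=> _ _; exists 0; rewrite ?ltNyr ?ltry.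
  have [d d0 dP] := xa a xa'.
  exists ([set y | norm1 (y - x) < d], [set j | (a%:E <= j)%E /\ (j < M)%E]) => /=.
    by split; [apply/nbhs_norm1P; exists d | exists a%:E].
  by case=> y j /= [yx [aj _]] Ky; apply: lt_le_trans aj; exact: dP.
case=> i /= iM /(_ i) /= iK; exfalso.
suff : (M <= i)%E by rewrite leNgt iM.
by apply: ge_ereal_sup => _ [w Kw <-]; apply/ltW/iK.
Qed.

Lemma usc_bounded K (u : V -> \bar R) : compact K -> usc_on K u ->
  exists c : R, forall w, K w -> (u w <= c%:E)%E.
Proof.
move=> cK uK; have [->|/set0P K0] := eqVneq K set0; first by exists 0.
have [z Kz zmax] := usc_max cK K0 uK.
have [zoo _] := uK z Kz.
case: (u z) zoo zmax => [r| |] // _ zmax; first by exists r.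
by exists 0 => w Kw; apply: le_trans (zmax w Kw) _; rewrite leNye.
Qed.

End Topology.

(** * Averages along curves *)
Section Mean.
Context {R : realType}.
Implicit Types (f g : R -> R) (a b L M : R).
Local Notation mu := (@lebesgue_measure R).

Lemma continuous_integrable f a b : continuous f -> mu.-integrable `[a, b] (EFin \o f).
Proof.
move=> cf; apply: continuous_compact_integrable; first exact: segment_compact.
exact: continuous_subspaceT.
Qed.

Lemma integral_itv_cst a b M : a <= b -> \int[mu]_(t in `[a, b]) M = M * (b - a).
Proof.
move=> ab; rewrite Rintegral_cst //= lebesgue_measure_itv /= lte_fin.
by case: ltgtP ab => // -> _; rewrite subrr.
Qed.

Lemma integral_itv_le f a b M : a <= b -> continuous f ->
  (forall t, a <= t <= b -> f t <= M) -> \int[mu]_(t in `[a, b]) f t <= M * (b - a).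
Proof.
move=> ab cf fM; rewrite -integral_itv_cst //; apply: le_Rintegral => //.
- exact: continuous_integrable.
- by apply: continuous_integrable => t; exact: cst_continuous.
Qed.

Lemma integral_itv_ge f a b M : a <= b -> continuous f ->
  (forall t, a <= t <= b -> M <= f t) -> M * (b - a) <= \int[mu]_(t in `[a, b]) f t.
Proof.
move=> ab cf fM; rewrite -integral_itv_cst //; apply: le_Rintegral => //.
- by apply: continuous_integrable => t; exact: cst_continuous.
- exact: continuous_integrable.
Qed.

Lemma integral_itv_cat f a b c : a <= b -> b <= c -> continuous f ->
  \int[mu]_(t in `[a, c]) f t = \int[mu]_(t in `[a, b]) f t + \int[mu]_(t in `[b, c]) f t.
Proof.
move=> ab bc cf; apply/eqP; rewrite addrC -subr_eq; apply/eqP.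
rewrite Rintegral_itvB ?bnd_simp //; last exact: continuous_integrable.
rewrite Rintegral_itv_obnd_cbnd //.
apply: integrableS (continuous_integrable b c cf) => //.
by apply: subset_itvr; rewrite bnd_simp.
Qed.

Lemma riemann_sum f l e (N : nat) : 0 <= l -> continuous f ->
  (forall (k : nat) t, k%:R * l <= t <= k.+1%:R * l -> `|f t - f (k%:R * l)| <= e) ->
  `|\int[mu]_(t in `[0, N%:R * l]) f t - l * \sum_(k < N) f (k%:R * l)| <= N%:R * l * e.
Proof.
move=> l0 cf fe; elim: N => [|N IHN].
  by rewrite big_ord0 mulr0 !mul0r set_itv1 Rintegral_set1 subrr normr0.
have N0 : 0 <= N%:R * l by rewrite mulr_ge0.
have NS : N%:R * l <= N.+1%:R * l by rewrite ler_wpM2r // ler_nat.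
have step : `|\int[mu]_(t in `[N%:R * l, N.+1%:R * l]) f t - l * f (N%:R * l)| <= l * e.
  have lE : N.+1%:R * l - N%:R * l = l by rewrite -mulrBl -natrB // subSnn mul1r.
  rewrite ler_distl; apply/andP; split.
    have -> : l * f (N%:R * l) - l * e =
        (f (N%:R * l) - e) * (N.+1%:R * l - N%:R * l) by rewrite lE; ring.
    apply: integral_itv_ge => // t /fe.
    by rewrite ler_distl => /andP[].
  have -> : l * f (N%:R * l) + l * e =
      (f (N%:R * l) + e) * (N.+1%:R * l - N%:R * l) by rewrite lE; ring.
  apply: integral_itv_le => // t /fe.
  by rewrite ler_distl => /andP[].
rewrite (integral_itv_cat N0 NS cf) big_ord_recr /= mulrDr opprD addrACA.
apply: le_trans (ler_normD _ _) _.
have -> : N.+1%:R * l * e = N%:R * l * e + l * e by rewrite -natr1; ring.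
exact: lerD.
Qed.

Definition mean L f := L^-1 * \int[mu]_(t in `[0, L]) f t.

Lemma eq_mean L f g : f =1 g -> mean L f = mean L g.
Proof. by move=> fg; congr (_ * _); apply: eq_Rintegral => t _; exact: fg. Qed.

Lemma mean_ge L f M : 0 < L -> continuous f ->
  (forall t, 0 <= t <= L -> M <= f t) -> M <= mean L f.
Proof.
move=> L0 cf fM; rewrite /mean mulrC ler_pdivlMr //.
by have := integral_itv_ge (ltW L0) cf fM; rewrite subr0.
Qed.

Lemma mean_cst L M : 0 < L -> mean L (fun=> M) = M.
Proof. by move=> L0; rewrite /mean integral_itv_cst ?ltW// subr0 mulrC mulfK ?gt_eqF. Qed.

Lemma meanD L f g : continuous f -> continuous g ->
  mean L (fun t => f t + g t) = mean L f + mean L g.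
Proof.
by move=> cf cg; rewrite /mean RintegralD ?mulrDr //; exact: continuous_integrable.
Qed.

Lemma meanZ L f M : continuous f -> mean L (fun t => M * f t) = M * mean L f.
Proof.
move=> cf; rewrite mulrCA; congr (_ * _).
have := @RintegralZl _ _ _ mu `[0, L]%classic f M; apply=> //; exact: continuous_integrable.
Qed.

Lemma mean_mono L f g : 0 < L -> continuous f -> continuous g ->
  (forall t, 0 <= t <= L -> f t <= g t) -> mean L f <= mean L g.
Proof.
move=> L0 cf cg fg; apply: ler_wpM2l; first by rewrite invr_ge0 ltW.
by apply: le_Rintegral => //; exact: continuous_integrable.
Qed.

Lemma mean_dist L f g e : 0 < L -> continuous f -> continuous g ->
  (forall t, 0 <= t <= L -> `|f t - g t| <= e) -> `|mean L f - mean L g| <= e.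
Proof.
move=> L0 cf cg fg.
have cc : continuous ((fun=> e) : R -> R) by move=> t; exact: cst_continuous.
have cD (h k : R -> R) : continuous h -> continuous k -> continuous (fun t => h t + k t).
  by move=> ch ck t; apply: continuousD; [exact: ch|exact: ck].
rewrite ler_distl -[in X in X && _](mean_cst e L0) -[in X in _ && X](mean_cst e L0).
rewrite lerBlDr -!meanD //.
apply/andP; split; apply: mean_mono => //; try exact: cD.
  by move=> t /fg; rewrite ler_distl lerBlDr => /andP[].
by move=> t /fg; rewrite ler_distl => /andP[].
Qed.

End Mean.

Section Average.
Context {R : realType} {n : nat}.
Local Notation C := R[i].
Local Notation V := 'rV[C]_n.
Implicit Types (z w b : V) (f : V -> R) (g : R -> V) (L e : R).

Definition lipschitz_curve g :=
  exists2 c : R, 0 < c & forall s t, norm1 (g s - g t) <= c * `|s - t|.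

(** Both the averages over segments, used for smoothing, and the means over
circles, which define plurisubharmonicity, are of this form. *)
Definition average L g f z := mean L (fun t => f (z + g t)).

Lemma uc_continuous f z : uc f -> {for z, continuous f}.
Proof.
move=> uf; apply/continuous_norm1P => e e0.
have [|d d0 dP] := uf (e / 2); first by rewrite divr_gt0.
exists d => // w /ltW/dP/le_lt_trans; apply.
by rewrite gtr_pMr // invf_lt1 // ltr1n.
Qed.

Lemma continuous_along g f z : lipschitz_curve g -> uc f ->
  continuous (fun t => f (z + g t)).
Proof.
move=> [c c0 gc] uf t; apply/cvgrPdist_le => e e0.
have [d d0 dP] := uf e e0.
exists (d / c) => /=; first by rewrite divr_gt0.
move=> s /= st; apply: dP; rewrite opprD addrACA subrr add0r.
apply: le_trans (gc _ _) _; rewrite mulrC -ler_pdivlMr //; exact: ltW.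
Qed.

Lemma average_ge L g f z M : 0 < L -> lipschitz_curve g -> uc f ->
  (forall t, 0 <= t <= L -> M <= f (z + g t)) -> M <= average L g f z.
Proof. by move=> L0 lg uf; apply: mean_ge => //; exact: continuous_along. Qed.

Lemma uc_cst (M : R) : uc (fun _ : V => M).
Proof. by move=> e e0; exists 1 => // z w _; rewrite subrr normr0 ltW. Qed.

Lemma ucD f1 f2 : uc f1 -> uc f2 -> uc (fun z => f1 z + f2 z).
Proof.
move=> u1 u2 e e0; have e2 : 0 < e / 2 by rewrite divr_gt0.
have [d1 d10 P1] := u1 _ e2; have [d2 d20 P2] := u2 _ e2.
exists (Order.min d1 d2); first by rewrite lt_min d10.
move=> z w; rewrite le_min => /andP[/P1 f1e /P2 f2e].
rewrite opprD addrACA; apply: le_trans (ler_normD _ _) _.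
by rewrite [leRHS]splitr lerD.
Qed.

Lemma ucZ f M : uc f -> uc (fun z => M * f z).
Proof.
move=> uf e e0; have c0 : 0 < `|M| + 1 by rewrite ltr_wpDl.
have [|d d0 dP] := uf (e / (`|M| + 1)); first by rewrite divr_gt0.
exists d => // z w /dP; rewrite -mulrBr normrM => fe.
apply: le_trans (_ : (`|M| + 1) * `|f w - f z| <= _); first by rewrite ler_wpM2r // lerDl.
by rewrite mulrC -ler_pdivlMr.
Qed.

Lemma uc_sum (I : Type) (r : seq I) (F : I -> V -> R) :
  (forall i, uc (F i)) -> uc (fun z => \sum_(i <- r) F i z).
Proof.
move=> uF; elim: r => [|i r IHr].
  by under eq_fun do rewrite big_nil; exact: uc_cst.
by under eq_fun do rewrite big_cons; exact: ucD.
Qed.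

Lemma uc_shift f b : uc f -> uc (fun z => f (z + b)).
Proof.
move=> uf e /uf[d d0 dP]; exists d => // z w zw; apply: dP.
by rewrite opprD addrACA subrr addr0.
Qed.

Lemma average_uc L g f : 0 < L -> lipschitz_curve g -> uc f -> uc (average L g f).
Proof.
move=> L0 lg uf e e0; have [d d0 dP] := uf e e0; exists d => // z w zw.
apply: mean_dist => //; try exact: continuous_along.
by move=> t _; apply: dP; rewrite opprD addrACA subrr addr0.
Qed.

Lemma averageD L g f1 f2 z : lipschitz_curve g -> uc f1 -> uc f2 ->
  average L g (fun z => f1 z + f2 z) z = average L g f1 z + average L g f2 z.
Proof. by move=> lg u1 u2; rewrite /average meanD //; exact: continuous_along. Qed.

Lemma averageZ L g f M z : lipschitz_curve g -> uc f ->
  average L g (fun z => M * f z) z = M * average L g f z.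
Proof. by move=> lg u1; rewrite /average meanZ //; exact: continuous_along. Qed.

Lemma average_sum L g (I : Type) (r : seq I) (F : I -> V -> R) z :
  0 < L -> lipschitz_curve g -> (forall i, uc (F i)) ->
  average L g (fun z => \sum_(i <- r) F i z) z = \sum_(i <- r) average L g (F i) z.
Proof.
move=> L0 lg uF; elim: r => [|i r IHr].
  by under [X in average _ _ X]eq_fun do rewrite big_nil; rewrite big_nil /average mean_cst.
under [X in average _ _ X]eq_fun do rewrite big_cons.
rewrite big_cons averageD ?IHr //; exact: uc_sum.
Qed.

Lemma average_shift L g f b z : average L g (fun z => f (z + b)) z = average L g f (z + b).
Proof. by apply: eq_mean => t; rewrite addrAC. Qed.

Lemma average_dist L g f1 f2 e z : 0 < L -> lipschitz_curve g -> uc f1 -> uc f2 ->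
  (forall z, `|f1 z - f2 z| <= e) -> `|average L g f1 z - average L g f2 z| <= e.
Proof. by move=> L0 lg u1 u2 fe; apply: mean_dist => //; exact: continuous_along. Qed.

Definition finite_average L g (N : nat) f z :=
  N%:R^-1 * \sum_(k < N) f (z + g (k%:R * (L / N%:R))).

(** The number of nodes depends only on the modulus of continuity of f and on the
Lipschitz constant of the curve, hence not on z. *)
Lemma finite_average_cvg L g f e : 0 < L -> lipschitz_curve g -> uc f -> 0 < e ->
  exists N0 : nat, forall N, (N0 <= N)%N -> forall z,
    `|average L g f z - finite_average L g N.+1 f z| <= e.
Proof.
move=> L0 lg uf e0; have [c c0 gc] := lg; have [d d0 dP] := uf e e0.
exists (Num.truncn (c * L / d)) => N N0N z.
have N0 : 0 < N.+1%:R :> R by rewrite ltr0n.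
set l := L / N.+1%:R.
have LE : L = N.+1%:R * l by rewrite /l mulrC divfK ?gt_eqF.
have l0 : 0 < l by rewrite divr_gt0.
have ld : c * l <= d.
  rewrite /l mulrA ler_pdivrMr // [leRHS]mulrC -ler_pdivrMr //; apply/ltW.
  by apply: lt_le_trans (truncnS_gt _) _; rewrite ler_nat ltnS.
have := @riemann_sum R (fun t => f (z + g t)) l e N.+1 (ltW l0) (continuous_along lg uf).
move=> H; rewrite /average /mean /finite_average -/l.
have -> : N.+1%:R^-1 = L^-1 * l.
  by rewrite {1}LE invfM -mulrA mulVf ?mulr1 // gt_eqF.
rewrite -mulrA -mulrBr normrM gtr0_norm ?invr_gt0 // mulrC ler_pdivrMr // [leRHS]mulrC.
rewrite -LE in H; apply: H => k t /andP[kt tk]; apply: dP.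
rewrite opprD addrACA subrr add0r; apply: le_trans (gc _ _) _.
apply: le_trans ld; rewrite ler_pM2l // ger0_norm ?subr_ge0 //.
by rewrite lerBlDr; move: tk; rewrite -natr1 mulrDl mul1r addrC.
Qed.

(** This stands in for Fubini: one of the averages is replaced, up to a uniform
error, by a finite average, which commutes with the other by linearity. *)
Lemma average_comm L1 L2 g1 g2 f z : 0 < L1 -> 0 < L2 ->
  lipschitz_curve g1 -> lipschitz_curve g2 -> uc f ->
  average L1 g1 (average L2 g2 f) z = average L2 g2 (average L1 g1 f) z.
Proof.
move=> L10 L20 l1 l2 uf; apply/eqP; rewrite -subr_eq0 -normr_le0.
apply/ler_addgt0Pl => e e0; rewrite addr0.
have e2 : 0 < e / 2 by rewrite divr_gt0.
have u2 := average_uc L20 l2 uf.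
have [N1 P1] := finite_average_cvg L10 l1 u2 e2.
have [N2 P2] := finite_average_cvg L10 l1 uf e2.
pose N := maxn N1 N2.
have us k : uc (fun z => f (z + g1 (k%:R * (L1 / N.+1%:R)))) by exact: uc_shift.
have uF : uc (finite_average L1 g1 N.+1 f) by apply: ucZ; exact: uc_sum.
have E : finite_average L1 g1 N.+1 (average L2 g2 f) z =
         average L2 g2 (finite_average L1 g1 N.+1 f) z.
  rewrite /finite_average averageZ //; last exact: uc_sum.
  rewrite average_sum //; congr (_ * _); apply: eq_bigr => k _.
  by rewrite average_shift.
apply: le_trans (ler_distD (finite_average L1 g1 N.+1 (average L2 g2 f) z) _ _) _.
rewrite [leRHS]splitr lerD //; first by apply: P1; exact: leq_maxl.
rewrite E; apply: average_dist => //; first exact: average_uc.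
by move=> w; rewrite distrC; apply: P2; exact: leq_maxr.
Qed.

End Average.

(** * Derivatives along lines and the classes C^k *)
Section OneVariable.
Context {R : realType}.
Implicit Types (f g : R -> R) (x d : R).

(** The derivative in increment form, so that h = 0 is not excluded and sums,
scalings and restrictions to an open set are immediate. *)
Definition deriv_at f x d := forall e : R, 0 < e ->
  exists2 r : R, 0 < r & forall h : R, `|h| < r -> `|f (x + h) - f x - d * h| <= e * `|h|.

Lemma deriv_atP f x d : deriv_at f x d <-> is_derive x 1 f d.
Proof.
have E (h : R) : h^-1 *: ((f \o shift x) (h *: 1) - f x) = (f (x + h) - f x) / h.
  by rewrite /= /GRing.scale /= mulr1 mulrC (addrC h).
have dist (h : R) : h != 0 ->
    `|d - (f (x + h) - f x) / h| * `|h| = `|f (x + h) - f x - d * h|.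
  by move=> h0; rewrite -normrM mulrBl divfK // distrC.
have cvgE : deriv_at f x d <->
    (fun h => h^-1 *: ((f \o shift x) (h *: 1) - f x)) @ 0^' --> d.
  split=> [fd|fd e e0].
    apply/cvgrPdist_le => e e0; have [r r0 rP] := fd e e0.
    exists r => //= h /= hr h0; rewrite E.
    have {}hr : `|f (x + h) - f x - d * h| <= e * `|h|.
      by apply: rP; rewrite -normrN -sub0r.
    by rewrite -(ler_pM2r (_ : 0 < `|h|)) ?normr_gt0 // dist.
  have /cvgrPdist_le/(_ e e0)[r /= r0 rP] := fd; exists r => // h hr.
  have [->|h0] := eqVneq h 0; first by rewrite addr0 subrr mulr0 subrr normr0 mulr0.
  rewrite -dist // ler_pM2r ?normr_gt0 // -E; apply: rP => //=.
  by rewrite sub0r normrN.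
rewrite cvgE; split=> [fd|[fx <-]]; last exact: fx.
by apply: DeriveDef; [apply/cvg_ex; exists d | apply: cvg_lim].
Qed.

Lemma deriv_atD f g x d d' : deriv_at f x d -> deriv_at g x d' ->
  deriv_at (fun t => f t + g t) x (d + d').
Proof. by move=> /deriv_atP fd /deriv_atP gd; apply/deriv_atP; exact: is_deriveD. Qed.

Lemma deriv_atB f g x d d' : deriv_at f x d -> deriv_at g x d' ->
  deriv_at (fun t => f t - g t) x (d - d').
Proof. by move=> /deriv_atP fd /deriv_atP gd; apply/deriv_atP; exact: is_deriveB. Qed.

Lemma deriv_atZ f x c d : deriv_at f x d -> deriv_at (fun t => c * f t) x (c * d).
Proof. by move=> /deriv_atP fd; apply/deriv_atP; exact: is_deriveZ. Qed.

Lemma deriv_at_shift f a x d : deriv_at f (a + x) d -> deriv_at (fun t => f (a + t)) x d.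
Proof. by move=> fd e /fd[r r0 rP]; exists r => // h /rP; rewrite addrA. Qed.

Lemma deriv_at_continuous f x d : deriv_at f x d -> {for x, continuous f}.
Proof. by move=> /deriv_atP[fd _]; apply/differentiable_continuous/derivable1_diffP. Qed.

Lemma mean_value f df a b : a <= b -> (forall x, a <= x <= b -> deriv_at f x (df x)) ->
  exists2 c, a <= c <= b & f b - f a = df c * (b - a).
Proof.
move=> ab fd; have [] := @MVT_segment R f df a b ab.
- move=> x /[!in_itv] /andP[/ltW ax /ltW xb]; apply/deriv_atP/fd.
  by apply/andP; split.
- apply: derivable_within_continuous => x /[!in_itv] /= xab.
  by have /deriv_atP[] := fd x xab.
by move=> c /[!in_itv] /= cab ->; exists c.
Qed.

(** Shifting the integrand shifts both end points of the interval, and the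
fundamental theorem of calculus applies at each of them. *)
Lemma integral_translate f L : 0 < L -> continuous f ->
  deriv_at (fun s => \int[lebesgue_measure]_(t in `[0, L]) f (s + t)) 0 (f L - f 0).
Proof.
move=> L0 cf.
(* The base point -1 leaves a neighbourhood of 0 on which F is differentiable. *)
pose F x := \int[lebesgue_measure]_(t in `[-1, x]) f t.
have dF x : -1 < x -> deriv_at F x (f x).
  move=> x1; apply/deriv_atP.
  have xu : x < x + 1 by rewrite ltrDl.
  have [dF <-] := continuous_FTC1_closed xu (continuous_integrable (-1) (x + 1) cf) x1 (cf x).
  by rewrite derive1E; exact: derivableP.
have E s : -1 < s -> \int[lebesgue_measure]_(t in `[0, L]) f (s + t) = F (s + L) - F s.
  move=> s1.
  have dFs t : 0 <= t -> deriv_at (fun t => F (s + t)) t (f (s + t)).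
    by move=> t0; apply/deriv_at_shift/dF; rewrite ltr_wpDr.
  have /= := @continuous_FTC2 R (fun t => f (s + t)) (fun t => F (s + t)) 0 L L0.
  rewrite addr0 /Rintegral => -> //.
  - apply: continuous_subspaceT => t; apply: continuous_comp (cf _).
    by apply: continuousD => //; exact: cst_continuous.
  - split.
    + by move=> t /[!in_itv]/= /andP[/ltW/dFs/deriv_atP[]].
    + by apply/cvg_at_right_filter/(deriv_at_continuous (dFs 0 _)).
    + by apply/cvg_at_left_filter/(deriv_at_continuous (dFs L _)); exact: ltW.
  - move=> t /[!in_itv]/= /andP[/ltW/dFs/deriv_atP[_ ]]; by rewrite derive1E.
have H : deriv_at (fun s => F (L + s) - F (0 + s)) 0 (f L - f 0).
  by apply: deriv_atB; apply: deriv_at_shift; rewrite addr0; apply: dF; lra.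
move=> e /H[r r0 rP]; exists (Order.min r 1); first by rewrite lt_min r0 ltr01.
move=> h; rewrite lt_min => /andP[/rP + h1]; rewrite !E ?add0r; [|lra|].
  by rewrite addr0 (addrC L).
by move: h1; rewrite ltr_norml => /andP[].
Qed.

End OneVariable.

Section PartialDerivatives.
Context {R : realType} {n : nat}.
Local Notation C := R[i].
Local Notation V := 'rV[C]_n.
Implicit Types (z w v b : V) (f g : V -> R) (U W : set V).

Definition is_rderiv v f z (d : R) := forall e : R, 0 < e ->
  exists2 r : R, 0 < r & forall h : R, `|h| < r ->
    `|f (z + h%:C *: v) - f z - d * h| <= e * `|h|.

Lemma complexR_add (s t : R) : (s + t)%:C = s%:C + t%:C.
Proof. by apply/eqP; rewrite eq_complex /= addr0 !eqxx. Qed.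

Lemma is_rderiv_line v f z t d : is_rderiv v f (z + t%:C *: v) d <->
  deriv_at (fun s : R => f (z + s%:C *: v)) t d.
Proof.
have E (h : R) : z + (t + h)%:C *: v = z + t%:C *: v + h%:C *: v.
  by rewrite (complexR_add t h) scalerDl addrA.
by split=> fd e /fd[r r0 rP]; exists r => // h /rP; rewrite E.
Qed.

Lemma is_rderivP v f z d :
  is_rderiv v f z d <-> rderivable v f z /\ rderiv v f z = d.
Proof.
have -> : is_rderiv v f z d <-> deriv_at (fun s : R => f (z + s%:C *: v)) 0 d.
  by rewrite -is_rderiv_line scale0r addr0.
rewrite deriv_atP /rderivable /rderiv derive1E; split=> [[]//|[fd <-]].
exact: derivableP.
Qed.

Lemma rderivE v f z d : is_rderiv v f z d -> rderiv v f z = d.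
Proof. by move=> /is_rderivP[]. Qed.

(** A derivative depends only on the values near the point; this is what lets the
classes Ck, which are defined through functions on the whole space, be handled on
an open subset. *)
Lemma is_rderiv_local v f g z d U : open U -> U z -> (forall w, U w -> f w = g w) ->
  is_rderiv v f z d -> is_rderiv v g z d.
Proof.
move=> /open_norm1P oU Uz fg fd e e0; have [r r0 rP] := fd e e0; have [s s0 sP] := oU z Uz.
have v0 : 0 < norm1 v + 1 by rewrite ltr_wpDl ?norm1_ge0.
exists (Order.min r (s / (norm1 v + 1))); first by rewrite lt_min r0 divr_gt0.
move=> h; rewrite lt_min => /andP[/rP hr hs]; rewrite -!fg //; apply: sP.
rewrite addrC addKr norm1Z; move: hs; rewrite ltr_pdivlMr // => /le_lt_trans; apply.
by rewrite ler_wpM2l // lerDl.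
Qed.

Lemma is_rderivD v f g z d d' : is_rderiv v f z d -> is_rderiv v g z d' ->
  is_rderiv v (fun w => f w + g w) z (d + d').
Proof.
rewrite -[z](addr0 z) -(scale0r v) => /is_rderiv_line fd /is_rderiv_line gd.
exact/is_rderiv_line/deriv_atD.
Qed.

Lemma is_rderivZ v f z (c d : R) : is_rderiv v f z d -> is_rderiv v (fun w => c * f w) z (c * d).
Proof.
rewrite -[z](addr0 z) -(scale0r v) => /is_rderiv_line fd.
exact/is_rderiv_line/deriv_atZ.
Qed.

Lemma Ck_continuous m U f z : Ck m U f -> U z -> {for z, continuous f}.
Proof. by case: m => [|m] [cf _]; exact: cf. Qed.

Lemma CkSP m U f : Ck m.+1 U f <->
  [/\ forall z, U z -> {for z, continuous f},
      forall j z, U z -> is_rderiv (cdir j) f z (rderiv (cdir j) f z) &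
      forall j, Ck m U (rderiv (cdir j) f)].
Proof.
split=> [[cf df]|[cf df kf]].
  split; first exact: cf.
  - case=> k c z Uz; have [dx dy _ _] := df k; apply/is_rderivP; split; last by [].
    by case: c; [exact: dy | exact: dx].
  - by case=> k []; have [_ _ kx ky] := df k; [exact: ky | exact: kx].
split; first exact: cf.
move=> k; split.
- by move=> z Uz; exact: (iffLR (is_rderivP _ _ _ _) (df (k, false) z Uz)).1.
- by move=> z Uz; exact: (iffLR (is_rderivP _ _ _ _) (df (k, true) z Uz)).1.
- exact: (kf (k, false)).
- exact: (kf (k, true)).
Qed.

Definition locally_Ck m U f := forall z, U z ->
  exists2 W : set V, open W /\ W z & exists2 g, Ck m W g & forall w, W w -> g w = f w.

Lemma locally_Ck_continuous m U f z : locally_Ck m U f -> U z -> {for z, continuous f}.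
Proof.
move=> loc Uz; have [W [oW Wz] [g kg gf]] := loc z Uz.
have /open_norm1P/(_ z Wz)[d d0 dP] := oW.
apply/continuous_norm1P => e e0.
have [r r0 rP] := iffLR (continuous_norm1P g z) (Ck_continuous kg Wz) e e0.
exists (Order.min d r); first by rewrite lt_min d0.
by move=> w; rewrite lt_min => /andP[/dP Ww /rP]; rewrite !gf.
Qed.

(** Used for a locally finite sum, which near each point is a finite one. *)
Lemma Ck_local m U f : locally_Ck m U f -> Ck m U f.
Proof.
elim: m f => [|m IHm] f loc.
  by split=> // z; exact: locally_Ck_continuous loc.
apply/CkSP; split=> [z|j z Uz|j]; first exact: locally_Ck_continuous loc.
  have [W [oW Wz] [g /CkSP[_ dg _] gf]] := loc z Uz.
  have H := is_rderiv_local oW Wz gf (dg j z Wz).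
  by rewrite (rderivE H).
apply: IHm => z Uz; have [W [oW Wz] [g /CkSP[_ dg kg] gf]] := loc z Uz.
exists W => //; exists (rderiv (cdir j) g) => // w Ww.
by rewrite (rderivE (is_rderiv_local oW Ww gf (dg j w Ww))).
Qed.

Lemma Ck_ext m U f g : open U -> (forall z, U z -> f z = g z) -> Ck m U f -> Ck m U g.
Proof. by move=> oU fg kf; apply: Ck_local => z Uz; exists U => //; exists f. Qed.

Lemma Ck_open_subset m U W f : W `<=` U -> Ck m U f -> Ck m W f.
Proof.
move=> WU; elim: m f => [|m IHm] f; first by move=> [cf _]; split => // z /WU/cf.
move=> /CkSP[cf df kf]; apply/CkSP; split=> [z /WU/cf|j z /WU/df|j] //; exact: IHm.
Qed.

Lemma CkD m U f g : open U -> Ck m U f -> Ck m U g -> Ck m U (fun z => f z + g z).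
Proof.
move=> oU; elim: m f g => [|m IHm] f g.
  by move=> [cf _] [cg _]; split=> // z Uz; apply: continuousD; [exact: cf|exact: cg].
move=> /CkSP[cf df kf] /CkSP[cg dg kg]; apply/CkSP; split=> [z Uz|j z Uz|j].
- by apply: continuousD; [exact: cf|exact: cg].
- have H := is_rderivD (df j z Uz) (dg j z Uz); by rewrite (rderivE H).
- apply: (Ck_ext oU _ (IHm _ _ (kf j) (kg j))) => z Uz.
  by rewrite (rderivE (is_rderivD (df j z Uz) (dg j z Uz))).
Qed.

Lemma CkZ m U (c : R) f : open U -> Ck m U f -> Ck m U (fun z => c * f z).
Proof.
move=> oU; elim: m f => [|m IHm] f.
  by move=> [cf _]; split=> // z Uz; apply: continuousM; [exact: cst_continuous|exact: cf].
move=> /CkSP[cf df kf]; apply/CkSP; split=> [z Uz|j z Uz|j].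
- by apply: continuousM; [exact: cst_continuous|exact: cf].
- have H := is_rderivZ c (df j z Uz); by rewrite (rderivE H).
- apply: (Ck_ext oU _ (IHm _ (kf j))) => z Uz.
  by rewrite (rderivE (is_rderivZ c (df j z Uz))).
Qed.

Lemma is_rderiv_cst v (c : R) z : is_rderiv v (fun _ : V => c) z 0.
Proof.
by move=> e e0; exists 1 => // h _; rewrite subrr mul0r subrr normr0 mulr_ge0 // ltW.
Qed.

Lemma Ck_cst m U (c : R) : Ck m U (fun _ : V => c).
Proof.
elim: m c => [|m IHm] c; first by split=> // z _; exact: cst_continuous.
apply/CkSP; split=> [z _|j z _|j]; first exact: cst_continuous.
  by rewrite (rderivE (is_rderiv_cst _ c z)); exact: is_rderiv_cst.
rewrite (_ : rderiv _ _ = (fun=> 0)) //; apply/funext => z.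
exact/rderivE/is_rderiv_cst.
Qed.

Lemma Ck_sum m U (I : Type) (r : seq I) (F : I -> V -> R) : open U ->
  (forall i, Ck m U (F i)) -> Ck m U (fun z => \sum_(i <- r) F i z).
Proof.
move=> oU kF; elim: r => [|i r IHr].
  by under eq_fun do rewrite big_nil; exact: Ck_cst.
by under eq_fun do rewrite big_cons; exact: CkD.
Qed.

End PartialDerivatives.

(** * Smoothing by averages over segments *)
Section Smoothing.
Context {R : realType} {n : nat}.
Local Notation C := R[i].
Local Notation V := 'rV[C]_n.
Implicit Types (z w b : V) (f : V -> R) (j : 'I_n * bool) (vs : seq ('I_n * bool)).

Definition segment b (t : R) : V := t%:C *: b.

Lemma lipschitz_segment b : lipschitz_curve (segment b).
Proof.
exists (norm1 b + 1); first by rewrite ltr_wpDl ?norm1_ge0.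
move=> s t; rewrite /segment -scalerBl -(rmorphB (real_complex R)) norm1Z mulrC.
by rewrite ler_wpM2r // lerDl.
Qed.

Definition box (d : R) j f := average d (segment (cdir j)) f.

Definition diffq (d : R) j f z := d^-1 * (f (z + d%:C *: cdir j) - f z).

(** The average over a segment differentiates to a difference quotient of f, so no
regularity of f beyond continuity is needed. *)
Lemma is_rderiv_box d j f z : 0 < d -> uc f ->
  is_rderiv (cdir j) (box d j f) z (diffq d j f z).
Proof.
move=> d0 uf; pose phi t := f (z + t%:C *: cdir j).
have cphi : continuous phi by exact: continuous_along (lipschitz_segment _) uf.
have phi0 : phi 0 = f z by rewrite /phi scale0r addr0.
have H := deriv_atZ d^-1 (integral_translate d0 cphi).
have z0 : z + 0%:C *: cdir j = z by rewrite scale0r addr0.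
have E : (fun s : R => box d j f (z + s%:C *: cdir j)) =
    (fun s => d^-1 * \int[lebesgue_measure]_(t in `[0, d]) phi (s + t)).
  apply/funext => s.
  apply: eq_mean => t.
  rewrite /phi /segment.
  rewrite (complexR_add s t).
  rewrite scalerDl.
  by rewrite addrA.
rewrite -[z in is_rderiv _ _ z]z0; apply/is_rderiv_line; rewrite E /diffq -phi0.
exact: H.
Qed.

Lemma diffq_uc d j f : uc f -> uc (diffq d j f).
Proof.
move=> uf; apply: ucZ; apply: ucD; first exact: uc_shift.
under eq_fun do rewrite -mulN1r; exact: ucZ.
Qed.

Definition boxes d vs f := foldr (box d) f vs.

Lemma boxes_uc d vs f : 0 < d -> uc f -> uc (boxes d vs f).
Proof.
move=> d0 uf; elim: vs => //= j vs IH; exact: average_uc (lipschitz_segment _) IH.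
Qed.

Lemma boxes_average d vs L g f : 0 < d -> 0 < L -> lipschitz_curve g -> uc f ->
  boxes d vs (average L g f) = average L g (boxes d vs f).
Proof.
move=> d0 L0 lg uf; elim: vs => [//|j vs IH]; rewrite /= IH; apply/funext => z.
apply: average_comm; [exact: d0|exact: L0|exact: lipschitz_segment|exact: lg|exact: boxes_uc].
Qed.

(** Averages commute, so any one of them can be performed last. *)
Lemma boxes_rem d vs j f : 0 < d -> uc f -> j \in vs ->
  boxes d vs f = box d j (boxes d (rem j vs) f).
Proof.
move=> d0 uf; elim: vs => [//|i vs IH]; rewrite in_cons eq_sym /=.
have [-> _|ij /= jvs] := eqVneq i j; first by [].
rewrite (IH jvs); apply/funext => z.
apply: average_comm; [exact: d0|exact: d0| | |].
- exact: lipschitz_segment.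
- exact: lipschitz_segment.
- exact: boxes_uc.
Qed.

Lemma boxes_diffq d vs j f : 0 < d -> uc f ->
  boxes d vs (diffq d j f) = diffq d j (boxes d vs f).
Proof.
move=> d0 uf; elim: vs => [//|i vs IH]; rewrite /= IH; apply/funext => z.
have ub := boxes_uc vs d0 uf; have ls := @lipschitz_segment (cdir i).
have us : uc (fun z => boxes d vs f (z + d%:C *: cdir j)) by exact: uc_shift.
have uz : uc (fun z => -1 * boxes d vs f z) by exact: ucZ.
have -> : diffq d j (boxes d vs f) =
    fun z => d^-1 * (boxes d vs f (z + d%:C *: cdir j) + -1 * boxes d vs f z).
  by apply/funext => w; rewrite mulN1r.
rewrite {1}/box averageZ; [|exact: ls|exact: ucD].
rewrite averageD; [|exact: ls|exact: us|exact: uz].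
rewrite averageZ; [|exact: ls|exact: ub].
by rewrite average_shift mulN1r.
Qed.

(** Differentiating along a coordinate uses up one average in that direction and
replaces f by a difference quotient of f, which is uniformly continuous again. *)
Lemma Ck_boxes m d vs f : 0 < d -> uc f -> (forall j, m <= count_mem j vs)%N ->
  Ck m setT (boxes d vs f).
Proof.
move=> d0; elim: m vs f => [|m IHm] vs f uf mvs.
  by split=> // z _; apply/uc_continuous/boxes_uc.
have der j z : is_rderiv (cdir j) (boxes d vs f) z (boxes d (rem j vs) (diffq d j f) z).
  have jvs : j \in vs by rewrite -has_pred1 has_count (leq_trans _ (mvs j)).
  rewrite boxes_diffq // (boxes_rem d0 uf jvs); exact/is_rderiv_box/boxes_uc.
apply/CkSP; split=> [z _|j z _|j]; first by apply/uc_continuous/boxes_uc.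
  by rewrite (rderivE (der j z)).
rewrite (_ : rderiv _ _ = boxes d (rem j vs) (diffq d j f)); last first.
  by apply/funext => z; exact/rderivE.
apply: IHm => [|i]; first exact: diffq_uc.
rewrite count_rem; apply: leq_trans (leq_sub2l _ (leq_b1 _)).
by rewrite subn1 -ltnS (leq_trans (mvs i)) // leqSpred.
Qed.

Lemma boxes_ge d vs f z M : 0 < d -> uc f ->
  (forall w, norm1 (w - z) <= (size vs)%:R * d -> M <= f w) -> M <= boxes d vs f z.
Proof.
move=> d0 uf; elim: vs z => [|j vs IH] z fM /=.
  by apply: fM; rewrite subrr norm10 mul0r.
apply: average_ge => //; [exact: lipschitz_segment | exact: boxes_uc |].
move=> t /andP[t0 td]; apply: IH => w wz; apply: fM.
apply: le_trans (norm1_triangle (z + segment (cdir j) t) _ _) _.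
have -> : z + segment (cdir j) t - z = segment (cdir j) t by rewrite addrC addKr.
rewrite norm1Z norm1_cdir mulr1 ger0_norm //=.
by rewrite -natr1 mulrDl mul1r lerD.
Qed.

Lemma boxesZ d vs c f : 0 < d -> uc f ->
  boxes d vs (fun z => c * f z) = fun z => c * boxes d vs f z.
Proof.
move=> d0 uf; elim: vs => [//|j vs IH]; rewrite /= IH; apply/funext => z.
by apply: averageZ; [exact: lipschitz_segment | exact: boxes_uc].
Qed.

Lemma boxesD d vs f1 f2 : 0 < d -> uc f1 -> uc f2 ->
  boxes d vs (fun z => f1 z + f2 z) = fun z => boxes d vs f1 z + boxes d vs f2 z.
Proof.
move=> d0 u1 u2; elim: vs => [//|j vs IH]; rewrite /= IH; apply/funext => z.
by apply: averageD; [exact: lipschitz_segment | exact: boxes_uc..].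
Qed.

Definition twice_coords : seq ('I_n * bool) := enum {: 'I_n * bool} ++ enum {: 'I_n * bool}.

(** The segments are short enough for the total displacement to be at most r. *)
Definition smooth (r : R) f := boxes (r / (size twice_coords).+1%:R) twice_coords f.

Let step_gt0 (r : R) : 0 < r -> 0 < r / (size twice_coords).+1%:R.
Proof. by move=> r0; rewrite divr_gt0. Qed.

Lemma Ck2_smooth r f : 0 < r -> uc f -> Ck 2 setT (smooth r f).
Proof.
move=> r0 uf; apply: Ck_boxes => // [|j]; first exact: step_gt0.
by rewrite count_cat !count_uniq_mem ?enum_uniq // mem_enum.
Qed.

Lemma smooth_uc r f : 0 < r -> uc f -> uc (smooth r f).
Proof. by move=> r0 uf; apply: boxes_uc => //; exact: step_gt0. Qed.

Lemma smooth_ge r f z M : 0 < r -> uc f ->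
  (forall w, norm1 (w - z) <= r -> M <= f w) -> M <= smooth r f z.
Proof.
move=> r0 uf fM; apply: boxes_ge => // [|w wz]; first exact: step_gt0.
apply: fM; apply: le_trans wz _.
by rewrite mulrA ler_pdivrMr // [leLHS]mulrC ler_pM2l // ler_nat.
Qed.

Lemma smooth_le r f z M : 0 < r -> uc f ->
  (forall w, norm1 (w - z) <= r -> f w <= M) -> smooth r f z <= M.
Proof.
move=> r0 uf fM; rewrite -lerN2.
have -> : - smooth r f z = smooth r (fun z => -1 * f z) z.
  by rewrite /smooth boxesZ; [rewrite mulN1r|exact: step_gt0|exact: uf].
apply: smooth_ge; [exact: r0|exact: ucZ|].
by move=> w /fM; rewrite mulN1r lerN2.
Qed.

Lemma smooth_average r L g f : 0 < r -> 0 < L -> lipschitz_curve g -> uc f ->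
  smooth r (average L g f) = average L g (smooth r f).
Proof. by move=> r0 L0 lg uf; apply: boxes_average => //; exact: step_gt0. Qed.

(** Smoothing commutes with the average and is monotone, so an excess e of the
average over the value, if it is present at all points within r of z, is still
present at z after smoothing. *)
Lemma smooth_submean r L g f z e : 0 < r -> 0 < L -> lipschitz_curve g -> uc f ->
  (forall w, norm1 (w - z) <= r -> f w + e <= average L g f w) ->
  smooth r f z + e <= average L g (smooth r f) z.
Proof.
move=> r0 L0 lg uf fe; have s0 := step_gt0 r0.
have ua := average_uc L0 lg uf; have un : uc (fun w => -1 * f w) by exact: ucZ.
rewrite -(smooth_average r0 L0 lg uf) addrC -lerBrDr.
have -> : smooth r (average L g f) z - smooth r f z =
    smooth r (fun w => average L g f w + -1 * f w) z.
  by rewrite /smooth (boxesD _ s0 ua un) (boxesZ _ _ s0 uf) mulN1r.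
apply: smooth_ge; [exact: r0|exact: ucD|].
by move=> w /fe; rewrite mulN1r lerBrDr addrC.
Qed.

Lemma smooth_close f e : uc f -> 0 < e ->
  exists2 r0 : R, 0 < r0 & forall r, 0 < r <= r0 -> forall z, `|smooth r f z - f z| <= e.
Proof.
move=> uf e0; have [d d0 dP] := uf e e0; exists d => // r /andP[r0 rd] z.
rewrite ler_distl; apply/andP; split; [apply: smooth_ge|apply: smooth_le] => // w wr;
  by have := dP z w (le_trans wr rd); rewrite ler_distl => /andP[].
Qed.

End Smoothing.

(** * Second order Taylor formula *)
Lemma addrKl (V : zmodType) (x y : V) : x + y - x = y.
Proof. by rewrite addrC addKr. Qed.

Lemma addrAKl (V : zmodType) (x y w : V) : x + y + w - x = y + w.
Proof. by rewrite -(addrA x) addrKl. Qed.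

Section DerivAtBasics.
Context {R : realType}.

Lemma deriv_at_cst (c x : R) : deriv_at (fun=> c) x 0.
Proof. by move=> e e0; exists 1 => // h _; rewrite subrr mul0r subrr normr0 mulr_ge0 // ltW. Qed.

Lemma deriv_at_lin (c x : R) : deriv_at (fun t => t * c) x c.
Proof.
move=> e e0; exists 1 => // h _.
have -> : (x + h) * c - x * c - c * h = 0 by ring.
by rewrite normr0 mulr_ge0 // ltW.
Qed.

Lemma deriv_at_half_sqr (x : R) : deriv_at (fun t => t ^+ 2 / 2) x x.
Proof.
move=> e e0; exists e => // h he.
have -> : (x + h) ^+ 2 / 2 - x ^+ 2 / 2 - x * h = h / 2 * h by field.
rewrite normrM; apply: ler_wpM2r => //; apply: le_trans (ltW he).
by rewrite normrM ler_piMr // ger0_norm ?invf_le1 ?ler1n.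
Qed.

End DerivAtBasics.

Section Taylor.
Context {R : realType} {n : nat}.
Local Notation C := R[i].
Local Notation V := 'rV[C]_n.
Implicit Types (p z w v b : V) (f : V -> R) (i j : 'I_n * bool) (U : set V).

Lemma is_rderiv_scale v f z (c d : R) : is_rderiv v f z d -> is_rderiv (c%:C *: v) f z (c * d).
Proof.
move=> fd e e0; have c0 : 0 < `|c| + 1 by rewrite ltr_wpDl.
have [|r r0 rP] := fd (e / (`|c| + 1)); first by rewrite divr_gt0.
exists (r / (`|c| + 1)); first by rewrite divr_gt0.
move=> h hr; rewrite scalerA -(rmorphM (real_complex R)) [c * d]mulrC -mulrA [c * h]mulrC.
have hc : `|h * c| <= `|h| * (`|c| + 1) by rewrite normrM ler_wpM2l // lerDl.
apply: le_trans (rP _ _) _; first by apply: le_lt_trans hc _; rewrite -ltr_pdivlMr.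
rewrite mulrAC ler_pdivrMr // -mulrA ler_wpM2l //; exact: ltW.
Qed.

Definition gradient_form f z b : R := \sum_j rcoord j b * rderiv (cdir j) f z.

Definition hess f z i j : R := rderiv (cdir i) (rderiv (cdir j) f) z.

Definition quad (m : 'I_n * bool -> 'I_n * bool -> R) b : R :=
  \sum_j \sum_i rcoord j b * (rcoord i b * m i j).

(** The increment along b is telescoped over the coordinates, and each term is
treated by the mean value theorem and the continuity of one partial derivative. *)
Lemma is_rderiv_gradient U f z b : open U -> Ck 1 U f -> U z ->
  is_rderiv b f z (gradient_form f z b).
Proof.
move=> oU /CkSP[cf df kf] Uz; rewrite {1}(rcoordE b) /gradient_form.
elim: (index_enum _) => [|j s IH].
  rewrite !big_nil => e e0; exists 1 => // h _.
  by rewrite scaler0 addr0 subrr mul0r subrr normr0 mulr_ge0 // ltW.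
rewrite !big_cons; set v := \sum_(i <- s) _ in IH *; set c := rcoord j b.
move=> e e0; have e2 : 0 < e / 2 by rewrite divr_gt0.
have [r1 r10 P1] := IH _ e2.
have c0 : 0 < `|c| + 1 by rewrite ltr_wpDl.
have [d1 d10 D1] := (iffLR (open_norm1P U) oU) z Uz.
have cont : {for z, continuous (rderiv (cdir j) f)} := Ck_continuous (kf j) Uz.
have [d2 d20 D2] := iffLR (continuous_norm1P _ z) cont _ (divr_gt0 e2 c0).
set k := norm1 v + `|c| + 1.
have k0 : 0 < k by rewrite ltr_wpDl // addr_ge0 ?norm1_ge0.
exists (Order.min r1 (Order.min d1 d2 / k)).
  by rewrite lt_min r10 divr_gt0 // lt_min d10.
move=> h; rewrite lt_min => /andP[hr1]; rewrite ltr_pdivlMr // lt_min => /andP[hd1 hd2].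
pose y := z + h%:C *: v.
have near s0 : 0 <= s0 <= 1 -> norm1 (y + s0%:C *: ((h * c)%:C *: cdir j) - z) <= `|h| * k.
  move=> /andP[s00 s01]; rewrite /y addrAKl.
  apply: le_trans (norm1D _ _) _.
  rewrite !norm1Z norm1_cdir mulr1 normrM (ger0_norm s00) /k !mulrDr mulr1 -addrA lerD //.
  by apply: le_trans (_ : `|h| * `|c| <= _); [rewrite ler_piMl // mulr_ge0 | rewrite lerDl].
have [|t tI] := @mean_value R (fun s => f (y + s%:C *: ((h * c)%:C *: cdir j)))
   (fun s => h * c * rderiv (cdir j) f (y + s%:C *: ((h * c)%:C *: cdir j))) 0 1 ler01.
  move=> s1 s1I; apply/is_rderiv_line/is_rderiv_scale/df/D1.
  exact: le_lt_trans (near s1 s1I) hd1.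
rewrite subr0 mulr1 scale1r scale0r addr0 => E.
have -> : z + h%:C *: (c%:C *: cdir j + v) = y + (h * c)%:C *: cdir j.
  by rewrite scalerDr scalerA -(rmorphM (real_complex R)) addrCA addrC.
set D := rderiv (cdir j) f z; set S := \sum_(i <- s) _.
have -> : f (y + (h * c)%:C *: cdir j) - f z - (c * D + S) * h =
   h * c * (rderiv (cdir j) f (y + t%:C *: ((h * c)%:C *: cdir j)) - D) +
   (f y - f z - S * h).
  by rewrite mulrBr -E; ring.
apply: le_trans (ler_normD _ _) _; rewrite [e]splitr mulrDl lerD //; last exact: P1.
have /ltW Dt := D2 _ (le_lt_trans (near t tI) hd2).
rewrite -mulrA normrM mulrC ler_wpM2r // normrM.
apply: le_trans (_ : (`|c| + 1) * (e / 2 / (`|c| + 1)) <= _); last by rewrite mulrC divfK ?gt_eqF.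
apply: ler_pM => //; by rewrite lerDl.
Qed.

Lemma is_rderiv_sum v (I : Type) (s : seq I) (F : I -> V -> R) z (d : I -> R) :
  (forall k, is_rderiv v (F k) z (d k)) ->
  is_rderiv v (fun w => \sum_(k <- s) F k w) z (\sum_(k <- s) d k).
Proof.
move=> dF; elim: s => [|k s IH].
  rewrite big_nil (_ : (fun w => _) = fun=> 0); first exact: is_rderiv_cst.
  by apply/funext => w; rewrite big_nil.
rewrite big_cons (_ : (fun w => _) = fun w => F k w + \sum_(k <- s) F k w).
  exact: is_rderivD (dF k) IH.
by apply/funext => w; rewrite big_cons.
Qed.

(** On the segment from p to p + b, the remainder and its derivative are bounded by
two uses of the mean value theorem; the second derivative along the segment is
close to that at p because the second order partials are continuous. *)
Lemma taylor2 U f p : open U -> Ck 2 U f -> U p -> forall e : R, 0 < e ->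
  exists2 d : R, 0 < d & forall b, norm1 b < d ->
    `|f (p + b) - f p - gradient_form f p b - quad (hess f p) b / 2| <= e * norm1 b ^+ 2.
Proof.
move=> oU kf Up e e0; have /CkSP[cf df kdf] := kf.
have k1f : Ck 1 U f.
  by apply/CkSP; split => // j; have /CkSP[cj _ _] := kdf j; split.
have [d1 d10 D1] := (iffLR (open_norm1P U) oU) p Up.
have [d2 d20 D2] : exists2 d : R, 0 < d & forall w, norm1 (w - p) < d ->
    forall i j, `|hess f w i j - hess f p i j| <= e.
  have H (ij : ('I_n * bool) * ('I_n * bool)) : exists d : R, 0 < d /\
     forall w, norm1 (w - p) < d -> `|hess f w ij.1 ij.2 - hess f p ij.1 ij.2| <= e.
    have /CkSP[_ _ /(_ ij.1) k0] := kdf ij.2.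
    have [d d0 dP] := iffLR (continuous_norm1P _ p) (Ck_continuous k0 Up) e e0.
    by exists d; split=> // w /dP/ltW.
  have [D DP] := choice H.
  exists (\big[Order.min/1]_ij D ij).
    elim/big_rec: _ => [|ij x _ x0]; first exact: ltr01.
    by rewrite lt_min x0 (DP ij).1.
  move=> w wd i j; apply: (DP (i, j)).2; apply: lt_le_trans wd _.
  by rewrite (bigD1 (i, j)) //= ge_min lexx.
exists (Order.min d1 d2); first by rewrite lt_min d10.
move=> b; rewrite lt_min => /andP[bd1 bd2].
have near t : 0 <= t <= 1 -> norm1 (p + t%:C *: b - p) <= norm1 b.
  move=> /andP[t0 t1]; rewrite addrKl norm1Z ger0_norm //.
  by rewrite ler_piMl // norm1_ge0.
pose F t := f (p + t%:C *: b); pose F1 t := gradient_form f (p + t%:C *: b) b.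
pose q t := quad (hess f (p + t%:C *: b)) b.
have dF t : 0 <= t <= 1 -> deriv_at F t (F1 t).
  move=> tI; apply/is_rderiv_line; apply: (is_rderiv_gradient _ oU k1f).
  by apply/D1/(le_lt_trans (near t tI)).
have dF1 t : 0 <= t <= 1 -> deriv_at F1 t (q t).
  move=> tI; apply: (iffLR (is_rderiv_line b (fun z => gradient_form f z b) p t (q t))).
  rewrite /q /quad /gradient_form.
  apply: (@is_rderiv_sum b _ _ (fun j w => rcoord j b * rderiv (cdir j) f w)) => j.
  rewrite -mulr_sumr; apply: is_rderivZ; apply: (is_rderiv_gradient _ oU (kdf j)).
  by apply/D1/(le_lt_trans (near t tI)).
have qE t : 0 <= t <= 1 -> `|q t - q 0| <= e * norm1 b ^+ 2.
  move=> tI; rewrite /q scale0r addr0 /quad -sumrB.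
  apply: le_trans (ler_norm_sum _ _ _) _.
  have -> : e * norm1 b ^+ 2 = \sum_j \sum_i `|rcoord j b| * (`|rcoord i b| * e).
    rewrite expr2 mulrC /norm1 !mulr_suml; apply: eq_bigr => j _.
    by rewrite -mulrA mulr_suml mulr_sumr.
  apply: ler_sum => j _; rewrite -sumrB; apply: le_trans (ler_norm_sum _ _ _) _.
  apply: ler_sum => i _; rewrite -!mulrBr !normrM.
  do 2!apply: ler_wpM2l => //; apply: D2; exact: le_lt_trans (near t tI) bd2.
pose G1 t := F1 t - F1 0 - t * q 0.
pose G t := F t - F 0 - t * F1 0 - q 0 * (t ^+ 2 / 2).
have dG1 t : 0 <= t <= 1 -> deriv_at G1 t (q t - q 0).
  move=> tI; rewrite -[q t]subr0; apply: deriv_atB (deriv_at_lin _ _).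
  exact: deriv_atB (dF1 t tI) (deriv_at_cst _ _).
have dG t : 0 <= t <= 1 -> deriv_at G t (G1 t).
  move=> tI; rewrite /G1 [t * _]mulrC; apply: deriv_atB; last first.
    exact/deriv_atZ/deriv_at_half_sqr.
  apply: deriv_atB (deriv_at_lin _ _).
  by rewrite -[F1 t]subr0; apply: deriv_atB (dF t tI) (deriv_at_cst _ _).
have I0 : 0 <= (0 : R) <= 1 by rewrite lexx ler01.
have G1e t : 0 <= t <= 1 -> `|G1 t| <= e * norm1 b ^+ 2.
  move=> /andP[t0 t1]; have [|s /andP[s0 st]] := @mean_value R G1 (fun t => q t - q 0) 0 t t0.
    by move=> s /andP[s0 st]; apply: dG1; rewrite s0 (le_trans st).
  have -> : G1 0 = 0 by rewrite /G1 mul0r subrr subr0.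
  rewrite !subr0 => ->.
  rewrite normrM (ger0_norm t0) -[leRHS]mulr1; apply: ler_pM => //.
  by apply: qE; rewrite s0 (le_trans st).
have [|s sI] := @mean_value R G G1 0 1 ler01; first exact: dG.
have G0 : G 0 = 0 by rewrite /G mul0r expr0n mul0r mulr0 subrr !subr0.
rewrite G0 subr0 subr0 mulr1 => E.
have := G1e s sI; rewrite -E.
suff -> : G 1 = f (p + b) - f p - gradient_form f p b - quad (hess f p) b / 2 by [].
by rewrite /G /F /F1 /q scale1r scale0r addr0 !mul1r expr1n mul1r.
Qed.

(** Two uses of the mean value theorem, first in direction i and then in j. *)
Lemma second_difference U f p i j (h : R) : open U -> Ck 2 U f -> 0 < h ->
  (forall w, norm1 (w - p) <= 2 * h -> U w) ->
  exists2 w, norm1 (w - p) <= 2 * h &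
    f (p + h%:C *: cdir i + h%:C *: cdir j) - f (p + h%:C *: cdir i)
     - (f (p + h%:C *: cdir j) - f p) = h ^+ 2 * hess f w j i.
Proof.
move=> oU kf h0 hU; have /CkSP[cf df kdf] := kf.
have nearij s t : 0 <= s <= h -> 0 <= t <= h ->
    norm1 (p + s%:C *: cdir i + t%:C *: cdir j - p) <= 2 * h.
  move=> /andP[s0 sh] /andP[t0 th]; rewrite addrAKl mulr2n mulrDl mul1r.
  apply: le_trans (norm1D _ _) _; rewrite !norm1Z !norm1_cdir !mulr1 !ger0_norm //.
  exact: lerD.
have hI : 0 <= h <= h by rewrite lexx ltW.
have I0 : 0 <= (0 : R) <= h by rewrite lexx ltW.
have neari s : 0 <= s <= h -> norm1 (p + s%:C *: cdir i - p) <= 2 * h.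
  by move=> sI; have := nearij s 0 sI I0; rewrite scale0r addr0.
have swap s : p + h%:C *: cdir j + s%:C *: cdir i = p + s%:C *: cdir i + h%:C *: cdir j.
  by rewrite addrAC.
pose phi s := f (p + h%:C *: cdir j + s%:C *: cdir i) - f (p + s%:C *: cdir i).
have [|s sI] := @mean_value R phi (fun s =>
    rderiv (cdir i) f (p + h%:C *: cdir j + s%:C *: cdir i)
     - rderiv (cdir i) f (p + s%:C *: cdir i)) 0 h (ltW h0).
  move=> s sI; apply: deriv_atB.
    apply: (iffLR (is_rderiv_line (cdir i) f (p + h%:C *: cdir j) s _)).
    apply: df; apply: hU; rewrite swap; apply: nearij => //; exact: sI.
  apply: (iffLR (is_rderiv_line (cdir i) f p s _)).
  apply: df; apply: hU; exact: (neari s sI).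
rewrite swap => E; have [|t tI] := @mean_value R
    (fun t => rderiv (cdir i) f (p + s%:C *: cdir i + t%:C *: cdir j))
    (fun t => hess f (p + s%:C *: cdir i + t%:C *: cdir j) j i) 0 h (ltW h0).
  move=> t tI.
  apply: (iffLR (is_rderiv_line (cdir j) (rderiv (cdir i) f) (p + s%:C *: cdir i) t _)).
  have /CkSP[_ dd _] := kdf i; apply: dd; apply: hU; exact: nearij.
rewrite scale0r addr0 => E2; rewrite {}E2 !subr0 in E.
exists (p + s%:C *: cdir i + t%:C *: cdir j); first exact: nearij.
have phi0 : phi 0 = f (p + h%:C *: cdir j) - f p by rewrite /phi scale0r !addr0.
have phih : phi h = f (p + h%:C *: cdir i + h%:C *: cdir j) - f (p + h%:C *: cdir i).
  by rewrite /phi swap.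
by rewrite -phih -phi0 E; ring.
Qed.

(** The second difference is symmetric in i and j, and divided by h^2 it is a
value near p of each of the two mixed derivatives. *)
Lemma clairaut U f p i j : open U -> Ck 2 U f -> U p -> hess f p i j = hess f p j i.
Proof.
move=> oU kf Up; apply/eqP; rewrite -subr_eq0 -normr_le0; apply/ler_addgt0Pl => e e0.
rewrite addr0; have e2 : 0 < e / 2 by rewrite divr_gt0.
have /CkSP[_ _ kdf] := kf.
have cont i' j' : exists2 d : R, 0 < d & forall w, norm1 (w - p) < d ->
    `|hess f w i' j' - hess f p i' j'| < e / 2.
  have /CkSP[_ _ /(_ i') k0] := kdf j'.
  exact: iffLR (continuous_norm1P _ p) (Ck_continuous k0 Up) _ e2.
have [d1 d10 D1] := cont i j; have [d2 d20 D2] := cont j i.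
have [d3 d30 D3] := (iffLR (open_norm1P U) oU) p Up.
pose d := Order.min d1 (Order.min d2 d3).
have d0 : 0 < d by rewrite !lt_min d10 d20.
pose h := d / 4; have h0 : 0 < h by rewrite divr_gt0.
have hd w : norm1 (w - p) <= 2 * h -> norm1 (w - p) < d.
  by move=> /le_lt_trans; apply; rewrite /h; lra.
have lt3 w : norm1 (w - p) <= 2 * h -> [/\ norm1 (w - p) < d1, norm1 (w - p) < d2 & norm1 (w - p) < d3].
  by move=> /hd; rewrite !lt_min => /andP[-> /andP[-> ->]].
have hU w : norm1 (w - p) <= 2 * h -> U w by move=> /lt3[_ _ /D3].
have [w1 /lt3[_ w1d _] E1] := second_difference i j oU kf h0 hU.
have [w2 /lt3[w2d _ _] E2] := second_difference j i oU kf h0 hU.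
have E : hess f w1 j i = hess f w2 i j.
  have h2 : h ^+ 2 != 0 by rewrite expf_neq0 // gt_eqF.
  apply: (mulfI h2); apply: etrans (esym E1) _; apply: etrans _ E2.
  have -> : p + h%:C *: cdir j + h%:C *: cdir i = p + h%:C *: cdir i + h%:C *: cdir j.
    by rewrite addrAC.
  have sw (x y z t : R) : x - y - (z - t) = x - z - (y - t) by ring.
  exact: sw.
have := D2 w1 w1d; have := D1 w2 w2d; rewrite E => H1 H2.
apply: le_trans (ler_distD (hess f w2 i j) _ _) _.
by rewrite [leRHS]splitr; apply: lerD; apply: ltW; [rewrite distrC; exact: H1|exact: H2].
Qed.

End Taylor.

(** * Signature of a Hermitian matrix *)
Section HermitianSignature.
Context {R : realType}.
Local Notation C := R[i].

Lemma char_poly_similar n (P P' A : 'M[C]_n) : P *m P' = 1%:M ->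
  char_poly (P' *m A *m P) = char_poly A.
Proof.
move=> PP; rewrite /char_poly.
have -> : char_poly_mx (P' *m A *m P) =
    map_mx polyC P' *m char_poly_mx A *m map_mx polyC P.
  rewrite /char_poly_mx mulmxBr mulmxBl !map_mxM; congr (_ - _).
  by rewrite scalar_mxC -mulmxA -map_mxM (mulmx1C PP) map_mx1 mulmx1.
by rewrite !det_mulmx mulrAC -det_mulmx -map_mxM (mulmx1C PP) map_mx1 det1 mul1r.
Qed.

(** The values are real when H is Hermitian; taking real parts makes this a real
valued function in all cases. *)
Definition herm_form n (H : 'M[C]_n) (x : 'rV[C]_n) : R :=
  complex.Re ((x *m H *m x^t*) 0 0).

Lemma ReD (x y : C) : complex.Re (x + y) = complex.Re x + complex.Re y.
Proof. by case: x y => ? ? []. Qed.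

Lemma Re_sum (I : Type) (r : seq I) (P : pred I) (F : I -> C) :
  complex.Re (\sum_(i <- r | P i) F i) = \sum_(i <- r | P i) complex.Re (F i).
Proof. exact: (big_morph _ ReD). Qed.

Lemma Im_real0 (x : C) : x \is Num.real -> complex.Im x = 0.
Proof. by case: x => a b; rewrite complex_real => /eqP. Qed.

Lemma herm_form_diag n (d : 'rV[C]_n) (x : 'rV[C]_n) : (forall j, d 0 j \is Num.real) ->
  herm_form (diag_mx d) x =
  \sum_j complex.Re (d 0 j) * (complex.Re (x 0 j) ^+ 2 + complex.Im (x 0 j) ^+ 2).
Proof.
move=> dr; rewrite /herm_form mxE Re_sum; apply: eq_bigr => j _.
rewrite mul_mx_diag !mxE; have /Im_real0 := dr j.
case: (d 0 j) (x 0 j) => a b [s t] /= ->.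
by ring.
Qed.

Section Spectral.
Context {n : nat} (H : 'M[C]_n).
Hypothesis hermH : H \is hermsymmx.
Let P := spectralmx H.
Let d := spectral_diag H.

Let unitP : P \is unitarymx. Proof. exact: spectral_unitarymx. Qed.

Let dreal j : d 0 j \is Num.real.
Proof. by have /mxOverP := hermitian_spectral_diag_real hermH; apply. Qed.

Let HE : H = P^t* *m diag_mx d *m P.
Proof.
by rewrite -(invmx_unitary unitP); exact/orthomx_spectralP/hermitian_normalmx.
Qed.

Let neg := [pred j : 'I_n | complex.Re (d 0 j) < 0].

Let eigenvaluesE : ominus H = #|neg|.
Proof.
rewrite /ominus /eigenvalues; case: closed_field_poly_normal => s /= sE.
have -> : count (fun x => x < 0) s = count (fun x => x < 0) [seq d 0 j | j <- enum 'I_n].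
  apply/permP/prod_XsubC_eq; move: sE.
  rewrite (monicP (char_poly_monic _)) scale1r => <-.
  rewrite HE char_poly_similar; last exact/unitarymxP.
  rewrite char_poly_trig ?diag_mx_is_trig // big_map enumT.
  by apply: eq_bigr => j _; rewrite mxE eqxx mulr1n.
rewrite count_map -sum1_card -sum1_count big_enum_cond /=; apply: eq_bigl => j /=;
  rewrite [in RHS]inE /=; by rewrite ltcE /= (Im_real0 (dreal j)) eqxx.
Qed.

Let herm_formE x : herm_form H x =
  \sum_j complex.Re (d 0 j) *
   (complex.Re ((x *m P^t*) 0 j) ^+ 2 + complex.Im ((x *m P^t*) 0 j) ^+ 2).
Proof.
rewrite -herm_form_diag // /herm_form {1}HE.
by rewrite trmx_mul map_mxM trmxCK !mulmxA.
Qed.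

(** The rows of A are q + 1 orthonormal eigenvectors for negative eigenvalues, and
-c bounds these eigenvalues from above. *)
Lemma ominus_gt_subspace q : (q < ominus H)%N ->
  exists2 A : 'M[C]_(q.+1, n), A \is unitarymx &
    exists2 c : R, 0 < c & forall b : 'rV_q.+1,
      herm_form H (b *m A) <= - (c * eucl_norm b ^+ 2).
Proof.
rewrite eigenvaluesE => qJ.
pose e (i : 'I_q.+1) : 'I_n := enum_val (widen_ord qJ i).
have einj : injective e.
  move=> i1 i2 /enum_val_inj/(congr1 val) /= E; exact: val_inj.
have eneg i : complex.Re (d 0 (e i)) < 0 by exact: (enum_valP (widen_ord qJ i)).
pose A := rowsub e P.
have PA : A *m P^t* = rowsub e 1%:M.
  by rewrite /A mul_rowsub_mx (unitarymxP unitP).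
exists A.
  apply/unitarymxP; apply/matrixP => i j; rewrite /A.
  have /matrixP/(_ (e i) (e j)) := unitarymxP unitP.
  rewrite !mxE (inj_eq einj) => <-; apply: eq_bigr => k _.
  by rewrite !mxE.
pose c := \big[Order.min/1]_(i < q.+1) (- complex.Re (d 0 (e i))).
exists c.
  rewrite /c; elim/big_rec: _ => [|i x _ x0]; first exact: ltr01.
  by rewrite lt_min x0 oppr_gt0 eneg.
move=> b.
have -> : herm_form H (b *m A) = herm_form (diag_mx (\row_i d 0 (e i))) b.
  rewrite /herm_form; congr (complex.Re (_ 0 0)).
  rewrite trmx_mul map_mxM !mulmxA; congr (_ *m _); rewrite -!mulmxA; congr (_ *m _).
  rewrite {1}HE !mulmxA PA -!mulmxA.
  have -> : P *m A^t* = (rowsub e 1%:M)^t*.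
    by rewrite -PA trmx_mul map_mxM trmxCK.
  apply/matrixP => i k; rewrite mul_rowsub_mx mul1mx !mxE (bigD1 (e k)) //= big1 => [|l lk].
    rewrite !mxE eqxx /= conjC1 mulr1 addr0 (inj_eq einj).
    by have [->|] := eqVneq i k.
  by rewrite !mxE [e k == l]eq_sym (negbTE lk) conjC0 mulr0.
rewrite herm_form_diag => [|i]; last by rewrite mxE.
rewrite /eucl_norm sqr_sqrtr; last by apply: sumr_ge0 => k _; rewrite addr_ge0 ?sqr_ge0.
rewrite mulr_sumr -sumrN; apply: ler_sum => i _; rewrite mxE -mulNr.
apply: ler_wpM2r; first by rewrite addr_ge0 ?sqr_ge0.
rewrite lerNr /c (bigD1 i) //=; by rewrite ge_min lexx.
Qed.

(** If there were at most q negative eigenvalues, some nonzero vector of the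
(q+1)-dimensional row space of A would be orthogonal to all their eigenvectors,
and the form would be nonnegative on it. *)
Lemma ominus_gt_of_negative q (A : 'M[C]_(q.+1, n)) :
  (forall b : 'rV_q.+1, b != 0 -> herm_form H (b *m A) < 0) -> (q < ominus H)%N.
Proof.
move=> negA; rewrite ltnNge; apply/negP; rewrite eigenvaluesE => Jq.
pose M : 'M[C]_(q.+1, #|neg|) := \matrix_(i, k) (A *m P^t*) i (enum_val k).
have : kermx M != 0.
  rewrite -mxrank_eq0 mxrank_ker subn_eq0 -ltnNge ltnS.
  exact: leq_trans (rank_leq_col M) Jq.
move=> /rowV0Pn[b /sub_kermxP bM b0].
have := negA b b0; apply/negP; rewrite -leNgt herm_formE; apply: sumr_ge0 => j _.
have [jneg|] := boolP (j \in neg); last first.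
  by rewrite inE -leNgt => d0; rewrite mulr_ge0 // addr_ge0 ?sqr_ge0.
suff -> : (b *m A *m P^t*) 0 j = 0 by rewrite /= expr0n addr0 mulr0.
have /matrixP/(_ 0 (enum_rank_in jneg j)) := bM.
rewrite [RHS]mxE => <-; rewrite -mulmxA [LHS]mxE [RHS]mxE; apply: eq_bigr => k _.
by rewrite [M _ _]mxE enum_rankK_in.
Qed.

End Spectral.
End HermitianSignature.

(** * Means over circles and the Levi form *)
Section CircleMean.
Context {R : realType}.

Lemma deriv_atM (f g : R -> R) (x d d' : R) : deriv_at f x d -> deriv_at g x d' ->
  deriv_at (fun t => f t * g t) x (f x * d' + g x * d).
Proof. by move=> /deriv_atP fd /deriv_atP gd; apply/deriv_atP; exact: is_deriveM. Qed.

Lemma continuous_trig_poly (c al be ga ka mu : R) :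
  continuous (fun t : R => c + al * cos t + be * sin t + ga * cos t ^+ 2 + ka * sin t ^+ 2
      + mu * (cos t * sin t)).
Proof.
move=> t; have cc : {for t, continuous (@cos R)} by exact: continuous_cos.
have cs : {for t, continuous (@sin R)} by exact: continuous_sin.
have ck (k : R) : {for t, continuous ((fun=> k) : R -> R)} by exact: cst_continuous.
have cM (f g : R -> R) : {for t, continuous f} -> {for t, continuous g} ->
  {for t, continuous (fun t => f t * g t)} by exact: continuousM.
have cD (f g : R -> R) : {for t, continuous f} -> {for t, continuous g} ->
  {for t, continuous (fun t => f t + g t)} by exact: continuousD.
have cX (f : R -> R) : {for t, continuous f} -> {for t, continuous (fun t => f t ^+ 2)}.
  by move=> fc; exact: (cM f f fc fc).
have cck (k : R) (f : R -> R) : {for t, continuous f} ->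
    {for t, continuous (fun t => k * f t)}.
  exact: (cM (fun=> k) f (ck k)).
have c1 := cD _ _ (cD _ _ (ck c) (cck al _ cc)) (cck be _ cs).
have c2 := cD _ _ c1 (cck ga _ (cX _ cc)).
have c3 := cD _ _ c2 (cck ka _ (cX _ cs)).
exact: (cD _ _ c3 (cck mu _ (cM _ _ cc cs))).
Qed.

Lemma mean_trig_poly (phi : R -> R) (c al be ga ka mu : R) :
  (forall t, phi t = c + al * cos t + be * sin t + ga * cos t ^+ 2 + ka * sin t ^+ 2
      + mu * (cos t * sin t)) ->
  mean (2 * pi) phi = c + (ga + ka) / 2.
Proof.
move=> phiE.
pose G (t : R) := t * c + al * sin t - be * cos t + (ga * ((t + sin t * cos t) / 2)
   + ka * ((t - sin t * cos t) / 2)) + mu * (sin t * sin t / 2).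
have dG t : deriv_at G t (phi t).
  have dc : deriv_at (@cos R) t (- sin t) by apply/deriv_atP; exact: is_derive_cos.
  have ds : deriv_at (@sin R) t (cos t) by apply/deriv_atP; exact: is_derive_sin.
  have d1 : deriv_at (fun t : R => t) t 1.
    by have := deriv_at_lin 1 t; under eq_fun do rewrite mulr1.
  have dh (f : R -> R) d : deriv_at f t d -> deriv_at (fun t => f t / 2) t (d / 2).
    move=> /(deriv_atZ 2^-1); under eq_fun do rewrite mulrC; by rewrite mulrC.
  have dsc := deriv_atM ds dc; have dss := deriv_atM ds ds.
  have := deriv_atD (deriv_atD (deriv_atB (deriv_atD (deriv_at_lin c t) (deriv_atZ al ds))
      (deriv_atZ be dc)) (deriv_atD (deriv_atZ ga (dh _ _ (deriv_atD d1 dsc)))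
      (deriv_atZ ka (dh _ _ (deriv_atB d1 dsc))))) (deriv_atZ mu (dh _ _ dss)).
  have E : c + al * cos t - be * - sin t + (ga * ((1 + (sin t * - sin t + cos t * cos t)) / 2)
     + ka * ((1 - (sin t * - sin t + cos t * cos t)) / 2)) +
     mu * ((sin t * cos t + sin t * cos t) / 2) = phi t.
    have h := cos2Dsin2 t.
    have -> : 1 + (sin t * - sin t + cos t * cos t) = 2 * cos t ^+ 2 by move: h; lra.
    have -> : 1 - (sin t * - sin t + cos t * cos t) = 2 * sin t ^+ 2 by move: h; lra.
    by rewrite phiE; field.
  by rewrite E.
have pi2 : 0 < 2 * pi :> R by rewrite mulr_gt0 ?pi_gt0.
have cphi : continuous phi.
  by rewrite (_ : phi = fun t => c + al * cos t + be * sin t + ga * cos t ^+ 2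
    + ka * sin t ^+ 2 + mu * (cos t * sin t)); [exact: continuous_trig_poly|exact/funext].
have cG t : {for t, continuous G} by exact: deriv_at_continuous (dG t).
rewrite /mean /Rintegral (@continuous_FTC2 R phi G 0 (2 * pi) pi2); last first.
- by move=> t _; have /deriv_atP[_] := dG t; rewrite derive1E.
- split; [|exact/cvg_at_right_filter/cG|exact/cvg_at_left_filter/cG].
  by move=> t _; have /deriv_atP[] := dG t.
- exact: continuous_subspaceT.
have c2 : cos (2 * pi) = 1 :> R by rewrite mulr_natl cos2pi.
have s2 : sin (2 * pi) = 0 :> R by rewrite mulr_natl sin2pi.
have pi0 : (pi : R) != 0 by rewrite gt_eqF // pi_gt0.
rewrite /= /G sin0 cos0 c2 s2; move: (pi : R) pi0 => p p0.
by field.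
Qed.

End CircleMean.

Section QuadraticForms.
Context {R : realType} {n : nat}.
Local Notation C := R[i].
Local Notation V := 'rV[C]_n.
Implicit Types (a b x y z : V) (m : 'I_n * bool -> 'I_n * bool -> R) (l : 'I_n * bool -> R).

Definition iunit : C := 0 +i* 1.

Definition lin l b : R := \sum_j rcoord j b * l j.

Definition bil m x y : R := \sum_j \sum_i rcoord j x * (rcoord i y * m i j).

Lemma linD l x y : lin l (x + y) = lin l x + lin l y.
Proof. by rewrite /lin -big_split; apply: eq_bigr => j _; rewrite rcoordD mulrDl. Qed.

Lemma linZ l (t : R) x : lin l (t%:C *: x) = t * lin l x.
Proof. by rewrite /lin mulr_sumr; apply: eq_bigr => j _; rewrite rcoordZ mulrA. Qed.

Lemma bilDl m x y z : bil m (x + y) z = bil m x z + bil m y z.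
Proof.
rewrite /bil -big_split; apply: eq_bigr => j _; rewrite -big_split; apply: eq_bigr => i _.
by rewrite rcoordD mulrDl.
Qed.

Lemma bilDr m x y z : bil m x (y + z) = bil m x y + bil m x z.
Proof.
rewrite /bil -big_split; apply: eq_bigr => j _; rewrite -big_split; apply: eq_bigr => i _.
by rewrite rcoordD mulrDl mulrDr.
Qed.

Lemma bilZl m (t : R) x y : bil m (t%:C *: x) y = t * bil m x y.
Proof.
rewrite /bil mulr_sumr; apply: eq_bigr => j _; rewrite mulr_sumr; apply: eq_bigr => i _.
by rewrite rcoordZ; ring.
Qed.

Lemma bilZr m (t : R) x y : bil m x (t%:C *: y) = t * bil m x y.
Proof.
rewrite /bil mulr_sumr; apply: eq_bigr => j _; rewrite mulr_sumr; apply: eq_bigr => i _.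
by rewrite rcoordZ; ring.
Qed.

Lemma quad_bil m x : quad m x = bil m x x. Proof. by []. Qed.

Definition circle b (t : R) : V := expi t *: b.

Lemma circleE b t : circle b t = (cos t)%:C *: b + (sin t)%:C *: (iunit *: b).
Proof.
rewrite /circle scalerA -scalerDl; congr (_ *: _); apply/eqP.
by rewrite eq_complex /=; apply/andP; split; apply/eqP; ring.
Qed.

Lemma lipschitz_circle b : lipschitz_curve (circle b).
Proof.
have lip (f f' : R -> R) : (forall t, deriv_at f t (f' t)) -> (forall t, `|f' t| <= 1) ->
    forall s t, `|f s - f t| <= `|s - t|.
  move=> df f1; have H s t : s <= t -> `|f t - f s| <= `|t - s|.
    move=> st; have [c _ ->] := @mean_value R f f' s t st (fun r _ => df r).
    by rewrite normrM ler_piMl.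
  move=> s t; have [/H //|/ltW/H ts] := leP t s.
  by rewrite distrC [leRHS]distrC.
have lc : forall s t : R, `|cos s - cos t| <= `|s - t|.
  apply: (lip _ (fun t => - sin t)) => t.
    by apply/deriv_atP; exact: is_derive_cos.
  by rewrite normrN ler_norml sin_geN1 sin_le1.
have ls : forall s t : R, `|sin s - sin t| <= `|s - t|.
  apply: (lip _ cos) => t; first by apply/deriv_atP; exact: is_derive_sin.
  by rewrite ler_norml cos_geN1 cos_le1.
exists (norm1 b + norm1 (iunit *: b) + 1).
  by rewrite ltr_wpDl // addr_ge0 ?norm1_ge0.
move=> s t; rewrite !circleE opprD addrACA -!scalerBl -!(rmorphB (real_complex R)).
apply: le_trans (norm1D _ _) _; rewrite !norm1Z mulrC.
rewrite mulrDl mul1r; apply: le_trans (_ : (norm1 b + norm1 (iunit *: b)) * `|s - t| <= _).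
  rewrite mulrDl; apply: lerD; first by apply: ler_wpM2l; rewrite ?norm1_ge0.
  by rewrite mulrC; apply: ler_wpM2l; rewrite ?norm1_ge0.
by rewrite lerDl.
Qed.

(** Along a circle, a real polynomial of degree two is a trigonometric polynomial;
only its constant term and the terms in cos^2 and sin^2 contribute to the mean. *)
Lemma quad_circle (c : R) l m a b t :
  c + lin l (a + circle b t) + quad m (a + circle b t) =
  (c + lin l a + quad m a) + (lin l b + (bil m a b + bil m b a)) * cos t
   + (lin l (iunit *: b) + (bil m a (iunit *: b) + bil m (iunit *: b) a)) * sin t
   + quad m b * cos t ^+ 2 + quad m (iunit *: b) * sin t ^+ 2
   + (bil m b (iunit *: b) + bil m (iunit *: b) b) * (cos t * sin t).
Proof.
rewrite circleE !quad_bil !linD !linZ !bilDl !bilDr !bilZl !bilZr.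
by ring.
Qed.

Lemma mean_quad_circle (c : R) l m a b :
  mean (2 * pi) (fun t => c + lin l (a + circle b t) + quad m (a + circle b t)) =
  c + lin l a + quad m a + (quad m b + quad m (iunit *: b)) / 2.
Proof. exact/mean_trig_poly/quad_circle. Qed.

Lemma continuous_quad_circle (c : R) l m a b :
  continuous (fun t => c + lin l (a + circle b t) + quad m (a + circle b t)).
Proof.
by rewrite (funext (quad_circle c l m a b)); exact: continuous_trig_poly.
Qed.

End QuadraticForms.

Section LeviForm.
Context {R : realType} {n : nat}.
Local Notation C := R[i].
Local Notation V := 'rV[C]_n.
Implicit Types (a b x y z p : V) (m : 'I_n * bool -> 'I_n * bool -> R) (f : V -> R).

(** The complex Hessian as a function of the real one: the pairs (k, false) and
(k, true) stand for the real and imaginary parts of the k-th coordinate. *)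
Definition levi_mx m : 'M[C]_n := \matrix_(k < n, l < n)
  (((m (k, false) (l, false) + m (k, true) (l, true)) / 4) +i*
   ((m (k, false) (l, true) - m (k, true) (l, false)) / 4)).

Lemma sum_coords (F : 'I_n * bool -> R) : \sum_j F j = \sum_k (F (k, true) + F (k, false)).
Proof.
transitivity (\sum_p F (p.1, p.2)); first by apply: eq_bigr => -[].
rewrite -(pair_bigA _ (fun (k : 'I_n) (c : bool) => F (k, c))) /=.
by apply: eq_bigr => k _; rewrite big_bool.
Qed.

Lemma herm_form_levi m b :
  herm_form (levi_mx m) b = (quad m b + quad m (iunit *: b)) / 4.
Proof.
rewrite /herm_form mxE Re_sum /quad !sum_coords -big_split mulr_suml.
apply: eq_bigr => l _; rewrite !sum_coords -!big_split /= mulr_suml mxE mulr_suml Re_sum.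
apply: eq_bigr => k _; rewrite /rcoord !mxE /=.
by case: (b 0 k) (b 0 l) => x y [s t] /=; field.
Qed.

Lemma levi_mx_herm m : (forall i j, m i j = m j i) -> levi_mx m \is hermsymmx.
Proof.
move=> sym; apply/is_hermitianmxP; rewrite expr0 scale1r; apply/matrixP => k l.
rewrite !mxE /= (sym (l, false)) (sym (l, true) (k, true)) (sym (l, false)).
rewrite (sym (l, true) (k, false)); apply/eqP; rewrite eq_complex /= eqxx /=.
by apply/eqP; ring.
Qed.

(** On a real-valued function the two Wirtinger derivatives reduce to real second
order partials. *)
Lemma complex_hessianE (U : set V) f p : open U -> Ck 2 U f -> U p ->
  complex_hessian f p = levi_mx (hess f p).
Proof.
move=> oU kf Up; have /CkSP[_ _ kdf] := kf.
have r0 v w : rderiv v (fun=> 0 : R) w = 0 by exact/rderivE/is_rderiv_cst.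
have half : (2^-1 : C) = (2^-1)%:C by rewrite rmorphV ?unitfE ?pnatr_eq0 // rmorph_nat.
have E l : dzbar l (fun w => (f w)%:C) =
    fun w => (2^-1 * rderiv (cdir (l, false)) f w) +i* (2^-1 * rderiv (cdir (l, true)) f w).
  apply/funext => w; rewrite /dzbar /rderivC /= !r0 half.
  rewrite -[dirx l]/(cdir (l, false)) -[diry l]/(cdir (l, true)).
  move: (rderiv (cdir (l, false)) f w) (rderiv (cdir (l, true)) f w) => s t.
  by apply/eqP; rewrite eq_complex /=; apply/andP; split; apply/eqP; ring.
have D j i : rderiv (cdir i) (fun w => 2^-1 * rderiv (cdir j) f w) p = 2^-1 * hess f p i j.
  apply/rderivE/is_rderivZ; have /CkSP[_ dd _] := kdf j; exact: dd.
apply/matrixP => k l; rewrite mxE [RHS]mxE E.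
pose F w : C := (2^-1 * rderiv (cdir (l, false)) f w) +i* (2^-1 * rderiv (cdir (l, true)) f w).
have RX : rderivC (dirx k) F p =
    (2^-1 * hess f p (k, false) (l, false)) +i* (2^-1 * hess f p (k, false) (l, true)).
  by congr (_ +i* _); exact: (D _ (k, false)).
have RY : rderivC (diry k) F p =
    (2^-1 * hess f p (k, true) (l, false)) +i* (2^-1 * hess f p (k, true) (l, true)).
  by congr (_ +i* _); exact: (D _ (k, true)).
rewrite -/F /dz RX RY half; move: (hess f p) => m.
by apply/eqP; rewrite eq_complex /=; apply/andP; split; apply/eqP; field.
Qed.

End LeviForm.

(** * Dominating an upper semicontinuous function *)
Section Exhaustion.
Context {R : realType} {n : nat}.
Local Notation C := R[i].
Local Notation V := 'rV[C]_n.
Implicit Types (p z w : V) (U : set V).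

(** The function k z is the infimum of e / (1 + |z - p|) and of the distance from z
to the complement of U. The first term makes its superlevel sets bounded, and
small around p at levels close to e; the second keeps them away from the boundary of U. *)
Lemma exhaustion U p (e : R) : 0 < e -> e <= 1 ->
  (forall w, norm1 (w - p) < e -> U w) -> open U ->
  exists k : V -> R,
   [/\ k p = e,
       forall z, k z <= e / (1 + norm1 (z - p)),
       forall z w, k z <= k w + norm1 (z - w),
       forall z, U z -> 0 < k z &
       forall z, 0 < k z -> U z].
Proof.
move=> e0 e1 eU oU.
pose S z : set R := [set x | x = e / (1 + norm1 (z - p)) \/ exists2 w, ~ U w & x = norm1 (z - w)].
pose k z := inf (S z).
have n0 z : 0 < 1 + norm1 (z - p) by rewrite ltr_wpDr ?norm1_ge0.
have S0 z : S z !=set0 by exists (e / (1 + norm1 (z - p))); left.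
have Slb z : has_lbound (S z).
  exists 0 => x [->|[w _ ->]]; last exact: norm1_ge0.
  by rewrite divr_ge0 // ltW.
have kle z x : S z x -> k z <= x by move=> Sx; exact: ge_inf.
have leK z c : (forall x, S z x -> c <= x) -> c <= k z.
  by move=> cS; apply: lb_le_inf => // x; exact: cS.
exists k; split.
- apply/eqP; rewrite eq_le; apply/andP; split.
    by apply: kle; left; rewrite subrr norm10 addr0 divr1.
  apply: leK => x [->|[w nUw ->]]; first by rewrite subrr norm10 addr0 divr1.
  by rewrite leNgt norm1_distC; apply/negP => /eU.
- by move=> z; apply: kle; left.
- move=> z w; rewrite -lerBlDr; apply: leK => x [->|[v nUv ->]]; rewrite lerBlDr.
    apply: le_trans (kle z _ (or_introl erefl)) _.
    rewrite -lerBlDl.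
    have tri := norm1_triangle z w p; rewrite (norm1_distC w z) in tri.
    have a0 := norm1_ge0 (z - p); have b0 := norm1_ge0 (w - p).
    move: tri a0 b0; move: (norm1 (z - p)) (norm1 (w - p)) (norm1_ge0 (z - w)).
    move: (norm1 (z - w)) => d a b d0 tri a0 b0.
    have -> : e / (1 + a) - e / (1 + b) = e * (b - a) / ((1 + a) * (1 + b)).
      by field; apply/andP; split; lra.
    rewrite ler_pdivrMr; last by apply: mulr_gt0; lra.
    apply: le_trans (_ : d * 1 <= _); last first.
      apply: ler_wpM2l => //; nra.
    rewrite mulr1; have [ab|/ltW ba] := leP b a; first by nra.
    by apply: le_trans (_ : 1 * (b - a) <= _); [apply: ler_wpM2r; lra|lra].
  apply: le_trans (kle z _ (or_intror (ex_intro2 _ _ v nUv erefl))) _.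
  by rewrite [leRHS]addrC; exact: norm1_triangle.
- move=> z Uz; have [d d0 dP] := (iffLR (open_norm1P U) oU) z Uz.
  apply: lt_le_trans (_ : Order.min d (e / (1 + norm1 (z - p))) <= _).
    by rewrite lt_min d0 divr_gt0.
  apply: leK => x [->|[w nUw ->]]; first by rewrite ge_min lexx orbT.
  rewrite ge_min leNgt norm1_distC; apply/orP; left; apply/negP => /dP; exact: nUw.
- move=> z kz; apply: contrapT => nUz; move: kz; apply/negP; rewrite -leNgt.
  by apply: kle; right; exists z => //; rewrite subrr norm10.
Qed.

Lemma compact_superlevel U p (e a : R) (k : V -> R) : 0 < a ->
  (forall z, k z <= e / (1 + norm1 (z - p))) ->
  (forall z w, k z <= k w + norm1 (z - w)) ->
  compact [set z | a <= k z].
Proof.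
move=> a0 ke kl; apply: (@compact_norm1 _ _ _ (e / a + norm1 p)).
  move=> z /= az; rewrite -[z in norm1 z](subrK p); apply: le_trans (norm1D _ _) _.
  rewrite lerD2r ler_pdivlMr //; have := le_trans az (ke z).
  rewrite ler_pdivlMr ?ltr_wpDr ?norm1_ge0 // mulrDr mulr1 [_ * a]mulrC.
  by move/(le_trans _); apply; rewrite lerDr ltW.
move=> z /= /negP; rewrite -ltNge => kza; exists (a - k z); first by rewrite subr_gt0.
move=> w wz; apply/negP; rewrite -ltNge.
by apply: le_lt_trans (kl w z) _; rewrite -ltrBrDl.
Qed.

(** Let a_0 > a_1 > ... decrease to 0, with k p = a_0 for the exhausting function k
and a_2 so close to a_0 that k z > a_2 forces |z - p| < rho. Then F is a sum of
c_i chi_i, where chi_i is the smoothing of a function of k; it vanishes where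
k >= a_i, is at least a positive constant where k <= a_(i+1), and c_i is chosen
from an upper bound of v on the compact set k >= a_(i+2). Near each point of U only
finitely many terms are nonzero. *)
Theorem domination U p (rho : R) (v : V -> \bar R) (M : R) : open U -> U p -> 0 < rho ->
  usc_on U v -> (forall w, U w -> norm1 (w - p) < rho -> (v w <= M%:E)%E) ->
  exists F : V -> R, [/\ Ck 2 U F, forall z, 0 <= F z,
    exists2 d : R, 0 < d & forall w, norm1 (w - p) < d -> F w = 0 &
    forall z, U z -> (v z <= (M + F z)%:E)%E].
Proof.
move=> oU Up rho0 uv vM.
have [e [e0 e1 eU]] : exists e : R, [/\ 0 < e, e <= 1 & forall w, norm1 (w - p) < e -> U w].
  have [d d0 dP] := (iffLR (open_norm1P U) oU) p Up.
  exists (Order.min d 1); split; rewrite ?lt_min ?d0 ?ltr01 // ?ge_min ?lexx ?orbT //.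
  by move=> w; rewrite lt_min => /andP[/dP].
have [k [kp ke kl k0 kU]] := exhaustion e0 e1 eU oU.
pose a (i : nat) : R := e / (1 + i%:R * (rho / 2)).
have den (i : nat) : 0 < 1 + i%:R * (rho / 2).
  by rewrite ltr_wpDr // mulr_ge0 // divr_ge0 // ltW.
have a0 : a 0%N = e by rewrite /a mul0r addr0 divr1.
have agt0 i : 0 < a i by rewrite divr_gt0.
have adec i : a i.+1 < a i.
  rewrite /a ltr_pM2l // ltf_pV2 ?posrE // ltrD2l ltr_pM2r ?divr_gt0 // ltr_nat //.
have aanti i j : (i <= j)%N -> a j <= a i.
  move=> ij; rewrite /a ler_pM2l // lef_pV2 ?posrE // lerD2l ler_pM2r ?divr_gt0 // ler_nat //.
pose tau i := (a i - a i.+1) / 4.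
have tau0 i : 0 < tau i by rewrite divr_gt0 // subr_gt0.
(* The ramp starts halfway between a_(i+1) and a_i: smoothing at scale tau_i, a
quarter of the gap, leaves chi_i = 0 for k z >= a_i - tau_i and chi_i >= tau_i for
k z <= a_(i+1). *)
pose f i z := Order.max 0 ((a i + a i.+1) / 2 - k z).
have uf i : uc (f i).
  move=> r r0; exists r => // z w wz; apply: le_trans wz.
  have h1 := kl z w; have h2 := kl w z; rewrite (norm1_distC z w) in h1.
  rewrite /f ler_distl.
  have [h3|h3] := leP 0 ((a i + a i.+1) / 2 - k z);
    have [h4|h4] := leP 0 ((a i + a i.+1) / 2 - k w); apply/andP; split; lra.
pose chi i := smooth (tau i) (f i).
have chi_ge0 i z : 0 <= chi i z.
  by apply: smooth_ge => // w _; rewrite /f le_max lexx.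
have chi0 i z : a i - tau i <= k z -> chi i z = 0.
  move=> kz; apply/eqP; rewrite eq_le chi_ge0 andbT; apply: smooth_le => // w wz.
  rewrite /f ge_max lexx /= subr_le0; have := kl z w; rewrite norm1_distC => h.
  by move: kz; rewrite /tau in wz *; lra.
have chi_tau i z : k z <= a i.+1 -> tau i <= chi i z.
  move=> kz; apply: smooth_ge => // w wz; rewrite /f le_max; apply/orP; right.
  by have h := kl w z; rewrite /tau in wz *; lra.
have kC i : compact [set z | a i <= k z] by exact: (compact_superlevel U _ ke kl).
have [Cb CbP] : exists Cb : nat -> R, forall i z, a i <= k z -> (v z <= (Cb i)%:E)%E.
  have H i : exists c : R, forall z, a i <= k z -> (v z <= c%:E)%E.
    have [c cP] := usc_bounded (kC i) (usc_onS (fun z kz => kU z (lt_le_trans (agt0 i) kz)) uv).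
    by exists c.
  by have [g gP] := choice H; exists g.
pose c i := Order.max 0 (Cb i.+2 - M) / tau i.
have c0 i : 0 <= c i by rewrite divr_ge0 ?(ltW (tau0 i)) // le_max lexx.
have exN z : exists N : nat, U z -> a N < k z.
  have [Uz|nUz] := pselect (U z); last by exists 0%N.
  exists (Num.truncn (e / (k z * (rho / 2)))).+1 => _.
  have kz := k0 z Uz; rewrite /a ltr_pdivrMr //.
  have := truncnS_gt (e / (k z * (rho / 2))).
  rewrite ltr_pdivrMr ?mulr_gt0 ?divr_gt0 // => H.
  by rewrite mulrDr mulr1 ltr_wpDl ?ltW // mulrCA.
have [N NP] := choice exN.
pose P m z := \sum_(i < m) c i * chi i z.
have PE m m' z : a m < k z -> (m <= m')%N -> P m' z = P m z.
  move=> am mm; rewrite /P -!(big_mkord xpredT (fun i => c i * chi i z)).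
  rewrite (big_cat_nat (n := m)) //= [X in _ + X]big_nat_cond [X in _ + X]big1 ?addr0 // => i.
  rewrite andbT => /andP[mi _]; rewrite chi0 ?mulr0 //.
  by apply: ltW; apply: le_lt_trans am; apply: le_trans (aanti _ _ mi); rewrite gerBl ltW.
pose F z := P (N z) z.
have FE m z : U z -> a m < k z -> F z = P m z.
  move=> Uz am; rewrite /F; have aN := NP z Uz.
  by have [/(PE _ _ _ aN) ->|/ltnW/(PE _ _ _ am) ->] := leqP (N z) m.
have P0 m z : 0 <= P m z by apply: sumr_ge0 => i _; rewrite mulr_ge0.
exists F; split.
- apply: Ck_local => z Uz; exists [set w | a (N z) < k w].
    split; last exact: NP.
    apply/open_norm1P => w /= aw; exists (k w - a (N z)); first by rewrite subr_gt0.
    by move=> y yw; have := kl w y; rewrite norm1_distC; lra.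
  exists (P (N z)).
    apply: Ck_open_subset (@subsetT _ _) _; apply: Ck_sum; first exact: openT.
    by move=> i; apply: CkZ; [exact: openT|exact: Ck2_smooth].
  by move=> w /= aw; rewrite (FE (N z)) //; apply: kU; exact: lt_trans aw.
- by move=> z; exact: P0.
- exists (tau 0%N) => // w wp; rewrite /F /P big1 // => i _; rewrite chi0 ?mulr0 //.
  have := kl p w; rewrite kp norm1_distC -a0 => h.
  have [i0|i0] := posnP i; first by rewrite i0; lra.
  have := aanti _ _ i0; have := tau0 i; have := adec 0%N; rewrite /tau in wp *; lra.
- move=> z Uz; have [k2|k2] := ltP (a 2%N) (k z).
    apply: le_trans (vM z Uz _) _; last by rewrite lee_fin lerDl; exact: P0.
    have n0 : 0 < 1 + norm1 (z - p) by rewrite ltr_wpDr ?norm1_ge0.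
    have := lt_le_trans k2 (ke z); rewrite /a ltr_pM2l // => H.
    have : 1 + norm1 (z - p) < 1 + 2%:R * (rho / 2) by rewrite -ltf_pV2 ?posrE.
    by lra.
  have exm : exists m, a m < k z by exists (N z); exact: NP.
  case: (ex_minnP exm) => m am mmin.
  have m2 : (2 < m)%N by rewrite ltnNge; apply/negP => /aanti h; move: (le_lt_trans h am); rewrite ltNge k2.
  case: m am mmin m2 => [|[|i]] // am mmin _.
  have kz : k z <= a i.+1 by rewrite leNgt; apply/negP => /mmin; rewrite ltnn.
  apply: le_trans (CbP i.+2 z (ltW am)) _; rewrite lee_fin (FE i.+2) //.
  rewrite -lerBlDl /P (bigD1 (@Ordinal i.+2 i (ltnW (ltnSn i.+1)))) //=.
  apply: le_trans (_ : c i * tau i <= _); first by rewrite /c divfK ?gt_eqF // le_max lexx orbT.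
  rewrite ler_wpDr //; first by apply: sumr_ge0 => j _; rewrite mulr_ge0.
  by apply: ler_wpM2l => //; exact: chi_tau.
Qed.

End Exhaustion.

(** * From q-plurisubharmonic to viscosity *)
Section Slices.
Context {R : realType}.
Local Notation C := R[i].

(** Linear maps are Lipschitz, by expansion along the real coordinate vectors. *)
Lemma norm1_mulmx_bound m n (A : 'M[C]_(m, n)) :
  exists2 c : R, 0 < c & forall z, norm1 (z *m A) <= c * norm1 z.
Proof.
exists (\sum_j norm1 (cdir j *m A) + 1).
  by rewrite ltr_wpDl // sumr_ge0 // => j _; exact: norm1_ge0.
move=> z; rewrite {1}(rcoordE z) mulmx_suml; apply: le_trans (norm1_sum _ _ _) _.
apply: le_trans (_ : (\sum_j norm1 (cdir j *m A)) * norm1 z <= _).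
  rewrite mulr_suml; apply: ler_sum => j _.
  rewrite -scalemxAl norm1Z mulrC; apply: ler_wpM2l; first exact: norm1_ge0.
  exact: le_rcoord_norm1.
by apply: ler_wpM2r; rewrite ?norm1_ge0 // lerDl.
Qed.

Lemma eucl_norm_herm n (z : 'rV[C]_n) : eucl_norm z ^+ 2 = complex.Re ((z *m z^t*) 0 0).
Proof.
rewrite /eucl_norm sqr_sqrtr; last by apply: sumr_ge0 => k _; rewrite addr_ge0 ?sqr_ge0.
rewrite mxE Re_sum; apply: eq_bigr => k _; rewrite !mxE.
by case: (z 0 k) => x y /=; ring.
Qed.

Lemma eucl_norm_unitary m n (A : 'M[C]_(m, n)) (w : 'rV[C]_m) : A \is unitarymx ->
  eucl_norm (w *m A) ^+ 2 = eucl_norm w ^+ 2.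
Proof.
move=> uA; rewrite !eucl_norm_herm trmx_mul map_mxM mulmxA -(mulmxA w).
by rewrite (unitarymxP uA) mulmx1.
Qed.

Lemma eucl_norm_iunit n (z : 'rV[C]_n) : eucl_norm (iunit *: z) ^+ 2 = eucl_norm z ^+ 2.
Proof.
rewrite /eucl_norm !sqr_sqrtr; try by apply: sumr_ge0 => k _; rewrite addr_ge0 ?sqr_ge0.
apply: eq_bigr => k _; rewrite mxE; case: (z 0 k) => x y /=; ring.
Qed.

Definition diag_quad n (i j : 'I_n * bool) : R := (i == j)%:R.

Lemma lin0 n (l : 'I_n * bool -> R) : lin l 0 = 0.
Proof. by rewrite /lin big1 // => j _; rewrite rcoord0 mul0r. Qed.

Lemma quad0 n (m : 'I_n * bool -> 'I_n * bool -> R) : quad m 0 = 0.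
Proof. by rewrite /quad big1 // => j _; rewrite big1 // => i _; rewrite rcoord0 mul0r. Qed.

Lemma quad_diag n (z : 'rV[C]_n) : quad (@diag_quad n) z = eucl_norm z ^+ 2.
Proof.
rewrite eucl_norm_rcoord; apply: eq_bigr => j _; rewrite (bigD1 j) //= big1 => [|i /negbTE ij].
  by rewrite /diag_quad eqxx mulr1 addr0 expr2.
by rewrite /diag_quad ij !mulr0.
Qed.

Lemma quad_lin n (m1 m2 : 'I_n * bool -> 'I_n * bool -> R) (s t : R) z :
  quad (fun i j => s * m1 i j + t * m2 i j) z = s * quad m1 z + t * quad m2 z.
Proof.
rewrite /quad !mulr_sumr -big_split; apply: eq_bigr => j _.
rewrite !mulr_sumr -big_split; apply: eq_bigr => i _ /=; ring.
Qed.

Lemma continuous_rcoord n j z : {for z, continuous (@rcoord R n j)}.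
Proof.
apply/continuous_norm1P => e e0; exists e => // w; apply: le_lt_trans.
by rewrite -rcoordB; exact: le_rcoord_norm1.
Qed.

Lemma continuous_sum n (I : Type) (r : seq I) (F : I -> 'rV[C]_n -> R) z :
  (forall i, {for z, continuous (F i)}) -> {for z, continuous (fun z => \sum_(i <- r) F i z)}.
Proof.
move=> cF; elim: r => [|i r IH].
  have -> : (fun z => \sum_(i <- [::]) F i z) = fun=> 0 by apply/funext => w; rewrite big_nil.
  exact: cst_continuous.
have -> : (fun z => \sum_(i <- i :: r) F i z) = fun z => F i z + \sum_(i <- r) F i z.
  by apply/funext => w; rewrite big_cons.
exact: continuousD (cF i) IH.
Qed.

Lemma continuous_lin n l (z : 'rV[C]_n) : {for z, continuous (lin l)}.
Proof.
apply: (@continuous_sum n _ _ (fun j z => rcoord j z * l j)) => j.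
apply: continuousM; [exact: continuous_rcoord|exact: cst_continuous].
Qed.

Lemma continuous_quad n m (z : 'rV[C]_n) : {for z, continuous (quad m)}.
Proof.
apply: (@continuous_sum n _ _ (fun j z => \sum_i rcoord j z * (rcoord i z * m i j))) => j.
apply: (@continuous_sum n _ _ (fun i z => rcoord j z * (rcoord i z * m i j))) => i.
apply: continuousM; first exact: continuous_rcoord.
apply: continuousM; [exact: continuous_rcoord|exact: cst_continuous].
Qed.

Lemma continuous_slice m n (A : 'M[C]_(m, n)) a (f : 'rV[C]_n -> R) w :
  {for a + w *m A, continuous f} -> {for w, continuous (fun w : 'rV[C]_m => f (a + w *m A))}.
Proof.
move=> /continuous_norm1P cf; apply/continuous_norm1P => e /cf[d d0 dP].
have [c c0 cA] := norm1_mulmx_bound A.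
exists (d / c); first by rewrite divr_gt0.
move=> y yw; apply: dP; rewrite opprD addrACA subrr add0r -mulmxBl.
by apply: le_lt_trans (cA _) _; rewrite mulrC -ltr_pdivlMr.
Qed.

Lemma mean_integral (L : R) (phi : R -> R) : continuous phi ->
  ((L^-1)%:E * \int[lebesgue_measure]_(t in `[0%R, L]) (phi t)%:E = (mean L phi)%:E)%E.
Proof.
move=> cphi; rewrite /mean /Rintegral EFinM fineK //.
by apply: integrable_fin_num => //; exact: continuous_integrable.
Qed.

Lemma usc_on_EFin n (V : set 'rV[C]_n) (h : 'rV[C]_n -> R) :
  (forall z, V z -> {for z, continuous h}) -> usc_on V (EFin \o h).
Proof.
move=> ch z Vz; split; first by rewrite /= ltry.
move=> a /=; rewrite lte_fin => ha.
have [|d d0 dP] := iffLR (continuous_norm1P h z) (ch z Vz) (a - h z); first by rewrite subr_gt0.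
apply/nbhs_norm1P; exists d => // w /dP; rewrite ltr_norml => /andP[_ H] _ /=.
by rewrite lte_fin; lra.
Qed.

Lemma ominus_le n (H : 'M[C]_n) : (ominus H <= n)%N.
Proof.
rewrite /ominus /eigenvalues; case: closed_field_poly_normal => s /= sE.
apply: leq_trans (count_size _ _) _.
have := size_char_poly H; rewrite sE (monicP (char_poly_monic _)) scale1r.
by rewrite size_prod_XsubC => -[->].
Qed.

(** By the mean value formula for quadratic polynomials, it is enough that the Levi
form is nonnegative on the directions of the slice. *)
Lemma quad_plurisubharmonic q n (A : 'M[C]_(q, n)) l m :
  (forall b, 0 <= quad m (b *m A) + quad m (iunit *: (b *m A))) ->
  plurisubharmonic setT (EFin \o (fun w => lin l (w *m A) + quad m (w *m A))).
Proof.
move=> mA; split.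
  apply: usc_on_EFin => z _.
  have -> : (fun w : 'rV[C]_q => lin l (w *m A) + quad m (w *m A)) =
      fun w => (fun x => lin l x + quad m x) (0 + w *m A).
    by apply/funext => w; rewrite add0r.
  apply: (@continuous_slice _ _ A 0 (fun x => lin l x + quad m x)).
  apply: continuousD; [exact: continuous_lin|exact: continuous_quad].
move=> a b _ /=.
have E t : lin l ((a + expi t *: b) *m A) + quad m ((a + expi t *: b) *m A) =
    0 + lin l (a *m A + circle (b *m A) t) + quad m (a *m A + circle (b *m A) t).
  by rewrite add0r mulmxDl -scalemxAl.
under eq_integral do rewrite E.
rewrite mean_integral; last exact: continuous_quad_circle.
rewrite mean_quad_circle add0r lee_fin lerDl divr_ge0 //; exact: mA.
Qed.

(** The polynomial h below is the opposite of the terms of order one and two of phi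
at p, corrected by - c |w|^2. The definite bound on the Levi form leaves enough
room for that correction. *)
Theorem qpsh_viscosity q n (U : set 'rV[C]_n) u : open U -> usc_on U u ->
  qpsh q U u -> viscosity_qpsh q U u.
Proof.
move=> oU uu psh.
have [|ninf] := pselect (forall z, U z -> u z = -oo%E); first by left.
right=> phi kphi p Up pmax; rewrite leqNgt; apply/negP => qH.
have qn : (q < n)%N by apply: leq_trans qH (ominus_le _).
have [r upE] : exists r : R, u p = r%:E.
  have [poo _] := uu p Up; case E : (u p) poo => [r| |] // _; first by exists r.
  exfalso; apply: ninf => z Uz; have := pmax z Uz; rewrite E /=.
  by case: (u z).
have hH : complex_hessian phi p \is hermsymmx.
  rewrite (complex_hessianE oU kphi Up); apply: levi_mx_herm => i j; exact: clairaut Up.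
have [A uA [c c0 cA]] := ominus_gt_subspace hH qH.
have [d1 d10 D1] := (iffLR (open_norm1P U) oU) p Up.
pose N : R := (n * 2)%:R + 1.
have N0 : 0 < N by rewrite ltr_wpDl.
(* N compares norm1 with the Euclidean norm, so the Taylor error on the sphere of
radius s is at most c s^2 / 2. *)
pose e := c / 2 / N ^+ 2.
have e0 : 0 < e by rewrite !divr_gt0 // exprn_gt0.
have [d2 d20 D2] := taylor2 oU kphi Up e0.
pose d := Order.min d1 d2.
have d0 : 0 < d by rewrite lt_min d10.
pose s := d / N / 2; have s0 : 0 < s by rewrite !divr_gt0.
have norm1A (w : 'rV[C]_q.+1) : norm1 (w *m A) <= N * eucl_norm w.
  apply: le_trans (norm1_le_eucl _) _.
  have -> : eucl_norm (w *m A) = eucl_norm w.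
    by apply/eqP; rewrite -(@eqrXn2 _ 2) // ?eucl_norm_ge0 // eucl_norm_unitary.
  by apply: ler_wpM2r; rewrite ?eucl_norm_ge0 // lerDl.
have small (w : 'rV[C]_q.+1) : eucl_norm w <= s -> norm1 (w *m A) < d.
  move=> ws; apply: le_lt_trans (norm1A w) _.
  apply: le_lt_trans (_ : N * s < _); first by rewrite ler_pM2l.
  have -> : N * s = d / 2 by rewrite /s; field; rewrite gt_eqF.
  by rewrite gtr_pMr // invf_lt1 // ltr1n.
pose l j := - rderiv (cdir j) phi p.
pose m i j := - (2^-1) * hess phi p i j + (- c) * diag_quad i j.
pose h (w : 'rV[C]_q.+1) := lin l (w *m A) + quad m (w *m A).
have linE x : lin l x = - gradient_form phi p x.
  by rewrite /lin /gradient_form -sumrN; apply: eq_bigr => j _; rewrite mulrN.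
have quadE w : quad m (w *m A) = - quad (hess phi p) (w *m A) / 2 - c * eucl_norm w ^+ 2.
  by rewrite quad_lin quad_diag eucl_norm_unitary //; ring.
have pshh : plurisubharmonic setT (EFin \o h).
  apply: quad_plurisubharmonic => b.
  rewrite quadE scalemxAl quadE -scalemxAl eucl_norm_iunit.
  have := cA b; rewrite (complex_hessianE oU kphi Up) herm_form_levi; lra.
have [inf|/(_ 0 s s0)] := psh qn p A uA.
  by have := inf 0; rewrite /= mul0mx addr0 upE => /(_ Up).
have ballU w : closed_eball 0 s w -> norm1 (w *m A) < d /\ U (p + w *m A).
  rewrite /closed_eball /= subr0 => /small wd; split => //; apply: D1.
  by rewrite addrKl (lt_le_trans wd) // ge_min lexx.
have sub0 : closed_eball 0 s `<=` [set w : 'rV[C]_q.+1 | U (p + w *m A)].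
  by move=> w /ballU[].
have ch z : [set: 'rV[C]_q.+1] z -> {for z, continuous h}.
  move=> _; have -> : h = fun w => (fun x => lin l x + quad m x) (0 + w *m A).
    by apply/funext => w; rewrite add0r.
  apply: (@continuous_slice _ _ A 0 (fun x => lin l x + quad m x)).
  apply: continuousD; [exact: continuous_lin|exact: continuous_quad].
move=> /(_ sub0 setT h openT (@subsetT _ _) ch pshh)[z zs zmax].
have z0 : closed_eball 0 s z by rewrite /closed_eball /= zs.
have c00 : closed_eball 0 s (0 : 'rV[C]_q.+1).
  by rewrite /closed_eball /= subrr; apply: le_trans (eucl_le_norm1 _) _; rewrite norm10 ltW.
have [zd zU] := ballU z z0.
have zE : eucl_norm z = s by rewrite -zs subr0.
have := zmax 0 c00; rewrite mul0mx addr0 upE.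
have h0 : h 0 = 0.
  by rewrite /h mul0mx lin0 quad0 addr0.
rewrite h0 adde0; apply/negP; rewrite -ltNge.
have := pmax _ zU; rewrite upE -EFinB leeBlDr //.
move=> uz; apply: le_lt_trans (leeD2r _ uz) _.
rewrite -!EFinD lte_fin.
have zd2 : norm1 (z *m A) < d2 by apply: lt_le_trans zd _; rewrite ge_min lexx orbT.
have := D2 _ zd2; rewrite ler_distl => /andP[_ T].
rewrite /h linE quadE zE.
have eN : e * norm1 (z *m A) ^+ 2 <= c / 2 * s ^+ 2.
  apply: le_trans (_ : e * (N * s) ^+ 2 <= _).
    apply: ler_wpM2l; first exact: ltW.
    have zN : norm1 (z *m A) <= N * s by rewrite -[in leRHS]zE; exact: norm1A.
    by rewrite ler_sqr ?nnegrE ?norm1_ge0 // mulr_ge0 // ltW.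
  by rewrite /e exprMn mulrA divfK // expf_neq0 // gt_eqF.
have cs : 0 < c * s ^+ 2 by rewrite mulr_gt0 // exprn_gt0.
by lra.
Qed.

End Slices.

(** * Strict sub-mean values, balls and extension *)
Section Converse.
Context {R : realType}.
Local Notation C := R[i].

Lemma two_pi_gt0 : 0 < 2 * pi :> R.
Proof. by rewrite mulr_gt0 ?pi_gt0. Qed.

Lemma norm1_disc n (x : C) (b : 'rV[C]_n) : `|x| <= 1 ->
  norm1 (x *: b) <= norm1 b + norm1 (iunit *: b).
Proof.
case: x => s t; rewrite normc_def lecR /= => x1.
have [s1 t1] : `|s| <= 1 /\ `|t| <= 1.
  have st1 : s ^+ 2 + t ^+ 2 <= 1.
    rewrite -(@ler_sqrt _ (s ^+ 2 + t ^+ 2) 1) // sqrtr1 //.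
  by split; rewrite -(@ler_sqr _ _ 1) ?nnegrE // real_normK ?num_real // expr1n;
     have := sqr_ge0 s; have := sqr_ge0 t; lra.
have -> : (s +i* t) *: b = s%:C *: b + t%:C *: (iunit *: b).
  rewrite scalerA -scalerDl; congr (_ *: _); apply/eqP.
  by rewrite eq_complex /=; apply/andP; split; apply/eqP; ring.
apply: le_trans (norm1D _ _) _; rewrite !norm1Z.
by apply: lerD; rewrite ler_piMl // norm1_ge0.
Qed.

Lemma normc_expi (t : R) : `|expi t : C| <= 1.
Proof. by rewrite normc_def /= cos2Dsin2 sqrtr1. Qed.

Lemma norm1_circle n (b : 'rV[C]_n) t :
  norm1 (circle b t) <= norm1 b + norm1 (iunit *: b).
Proof. exact/norm1_disc/normc_expi. Qed.

Lemma quadZ n m (t : R) (x : 'rV[C]_n) : quad m (t%:C *: x) = t ^+ 2 * quad m x.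
Proof. by rewrite !quad_bil bilZl bilZr mulrA expr2. Qed.

Lemma scale_iunitC n (t : R) (x : 'rV[C]_n) : iunit *: (t%:C *: x) = t%:C *: (iunit *: x).
Proof. by rewrite !scalerA mulrC. Qed.

(** Taylor's formula turns the inequality on the circle of radius s into
k s^2 <= s^2 (D(x) + D(ix)) / 4 + o(s^2), where D is the second derivative. *)
Lemma levi_of_submean n (G : 'rV[C]_n -> R) p x (k s0 : R) :
  Ck 2 setT G -> uc G -> 0 < k -> 0 < s0 ->
  (forall s, 0 < s < s0 -> G p + k * s ^+ 2 <= average (2 * pi) (circle (s%:C *: x)) G p) ->
  0 < quad (hess G p) x + quad (hess G p) (iunit *: x).
Proof.
move=> kG uG k0 s00 sub.
pose be := norm1 x + norm1 (iunit *: x).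
have be0 : 0 <= be by rewrite addr_ge0 ?norm1_ge0.
pose e := k / 2 / (be ^+ 2 + 1).
have b1 : 0 < be ^+ 2 + 1 by rewrite ltr_wpDl ?sqr_ge0.
have e0 : 0 < e by rewrite !divr_gt0.
have [d d0 dP] := taylor2 openT kG (I : setT p) e0.
pose s := Order.min s0 (d / (be + 1)) / 2.
have m0 : 0 < Order.min s0 (d / (be + 1)) by rewrite lt_min s00 divr_gt0 // ltr_wpDl.
have sI : 0 < s < s0.
  rewrite divr_gt0 //=; apply: lt_le_trans (_ : Order.min s0 (d / (be + 1)) <= _).
    by rewrite gtr_pMr // invf_lt1 // ltr1n.
  by rewrite ge_min lexx.
have sd : s * be < d.
  apply: le_lt_trans (_ : s * (be + 1) < _).
    by apply: ler_wpM2l; [case/andP: sI => /ltW | rewrite lerDl].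
  rewrite -ltr_pdivlMr ?ltr_wpDl //.
  apply: lt_le_trans (_ : Order.min s0 (d / (be + 1)) <= _).
    by rewrite gtr_pMr // invf_lt1 // ltr1n.
  by rewrite ge_min lexx orbT.
have [/ltW s_ge0 _] := andP sI.
have nc t : norm1 (circle (s%:C *: x) t) <= s * be.
  apply: le_trans (norm1_circle _ _) _.
  by rewrite scale_iunitC !norm1Z (ger0_norm s_ge0) -mulrDr.
pose l j := rderiv (cdir j) G p.
pose m i j := 2^-1 * hess G p i j + 0 * hess G p i j.
have mE y : quad m y = quad (hess G p) y / 2.
  by rewrite quad_lin mul0r addr0 mulrC.
pose c0 := G p + e * (s * be) ^+ 2.
have ub : average (2 * pi) (circle (s%:C *: x)) G p <=
   mean (2 * pi) (fun t => c0 + lin l (0 + circle (s%:C *: x) t) + quad m (0 + circle (s%:C *: x) t)).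
  apply: mean_mono; first exact: two_pi_gt0.
  - exact: continuous_along (lipschitz_circle _) uG.
  - exact: continuous_quad_circle.
  move=> t _; rewrite add0r mE.
  have := dP _ (le_lt_trans (nc t) sd); rewrite ler_distl => /andP[_ T].
  have : e * norm1 (circle (s%:C *: x) t) ^+ 2 <= e * (s * be) ^+ 2.
    apply: ler_wpM2l; first exact: ltW.
    by apply: lerXn2r (nc t); rewrite nnegrE; [exact: norm1_ge0|exact: mulr_ge0].
  rewrite -[lin l _]/(gradient_form G p (circle (s%:C *: x) t)) /c0.
  move: T; move: (G _) (G p) (gradient_form _ _ _) (quad _ _) => *; lra.
rewrite mean_quad_circle lin0 quad0 !addr0 !mE scale_iunitC !quadZ in ub.
have := le_trans (sub s sI) ub; rewrite /c0.
have s2 : 0 < s ^+ 2 by rewrite exprn_gt0 //; case/andP: sI.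
set Q1 := quad _ x; set Q2 := quad _ (iunit *: x).
move=> H.
have {}H : k * s ^+ 2 <= (e * be ^+ 2 + (Q1 + Q2) / 4) * s ^+ 2.
  clearbody Q1 Q2 e be s; move: H; rewrite exprMn.
  by move: (s ^+ 2) (be ^+ 2) (G p) => S B g H; nra.
rewrite ler_pM2r // in H.
have : e * be ^+ 2 <= k / 2.
  rewrite /e mulrAC ler_pdivrMr // ler_pM2l ?divr_gt0 //; lra.
by lra.
Qed.

Lemma continuous_along_at n (g : R -> 'rV[C]_n) (f : 'rV[C]_n -> R) z : lipschitz_curve g ->
  (forall t, {for z + g t, continuous f}) -> continuous (fun t => f (z + g t)).
Proof.
move=> [c c0 gc] cf t; apply/cvgrPdist_lt => e e0.
have [d d0 dP] := iffLR (continuous_norm1P f (z + g t)) (cf t) e e0.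
exists (d / c) => /=; first by rewrite divr_gt0.
move=> s /= st; rewrite distrC; apply: dP; rewrite opprD addrACA subrr add0r.
by apply: le_lt_trans (gc _ _) _; rewrite mulrC -ltr_pdivlMr // distrC.
Qed.

Lemma compact_sublevel n (g : 'rV[C]_n -> R) (c M : R) :
  (forall z, {for z, continuous g}) -> (forall z, g z <= c -> norm1 z <= M) ->
  compact [set z | g z <= c].
Proof.
move=> cg gM; apply: (@compact_norm1 _ _ _ M) => [z|z /= /negP]; first exact: gM.
rewrite -ltNge => cz.
have [|d d0 dP] := iffLR (continuous_norm1P g z) (cg z) (g z - c); first by rewrite subr_gt0.
exists d => // w /dP; rewrite ltr_norml => /andP[H _] /=.
by apply/negP; rewrite -ltNge; lra.
Qed.

Lemma continuous_shift n (f : 'rV[C]_n -> R) (c z : 'rV[C]_n) : {for z - c, continuous f} ->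
  {for z, continuous (fun w : 'rV[C]_n => f (w - c))}.
Proof.
move=> /continuous_norm1P cf; apply/continuous_norm1P => e /cf[d d0 dP]; exists d => // w wz.
by apply: dP; rewrite opprB addrA subrK.
Qed.

Lemma continuous_sqdist n (c z : 'rV[C]_n) :
  {for z, continuous (fun w : 'rV[C]_n => eucl_norm (w - c) ^+ 2)}.
Proof.
have -> : (fun w : 'rV[C]_n => eucl_norm (w - c) ^+ 2) = fun w => quad (@diag_quad R n) (w - c).
  by apply/funext => w; rewrite quad_diag.
exact/continuous_shift/continuous_quad.
Qed.

Lemma closed_eballE n (c : 'rV[C]_n) r : 0 <= r ->
  closed_eball c r = [set z | eucl_norm (z - c) ^+ 2 <= r ^+ 2].
Proof.
by move=> r0; apply/seteqP; split=> z /=; rewrite ler_sqr ?nnegrE ?eucl_norm_ge0.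
Qed.

Lemma norm1_eball n (c z : 'rV[C]_n) r : eucl_norm (z - c) <= r ->
  norm1 z <= (n * 2)%:R * r + norm1 c.
Proof.
move=> zr; rewrite -[z in norm1 z](subrK c); apply: le_trans (norm1D _ _) _.
rewrite lerD2r; apply: le_trans (norm1_le_eucl _) _; exact: ler_wpM2l.
Qed.

Lemma compact_closed_eball n (c : 'rV[C]_n) r : 0 <= r -> compact (closed_eball c r).
Proof.
move=> r0; rewrite closed_eballE //.
apply: (@compact_sublevel _ _ _ ((n * 2)%:R * r + norm1 c)); first exact: continuous_sqdist.
by move=> z; rewrite ler_sqr ?nnegrE ?eucl_norm_ge0 // => /norm1_eball.
Qed.

Lemma compact_esphere n (c : 'rV[C]_n) r : 0 <= r -> compact (esphere c r).
Proof.
move=> r0; have -> : esphere c r = [set z | `|eucl_norm (z - c) ^+ 2 - r ^+ 2| <= 0].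
  apply/seteqP; split=> z /=; first by move=> ->; rewrite subrr normr0.
  rewrite normr_le0 subr_eq0 eqrXn2 ?eucl_norm_ge0 // => /eqP.
  exact.
apply: (@compact_sublevel _ _ _ ((n * 2)%:R * r + norm1 c)).
  move=> z; apply/continuous_norm1P => e e0.
  have [d d0 dP] := iffLR (continuous_norm1P _ z) (@continuous_sqdist n c z) e e0.
  exists d => // w /dP; apply: le_lt_trans; apply: le_trans (ler_dist_dist _ _) _.
  by rewrite opprB addrA subrK.
move=> z; rewrite normr_le0 subr_eq0 eqrXn2 ?eucl_norm_ge0 // => /eqP zr.
by apply: norm1_eball; rewrite zr.
Qed.

Lemma esphere_nonempty n (c : 'rV[C]_n.+1) r : 0 <= r -> esphere c r !=set0.
Proof.
move=> r0; exists (c + r%:C *: cdir (ord0, false)); rewrite /esphere /=.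
rewrite addrKl; apply/eqP; rewrite -(@eqrXn2 _ 2) ?eucl_norm_ge0 //.
rewrite -quad_diag quadZ quad_diag eucl_norm_rcoord (bigD1 (ord0, false)) //= big1.
  by rewrite rcoord_cdir eqxx expr1n addr0 mulr1.
by move=> j /negbTE j0; rewrite rcoord_cdir j0 expr0n.
Qed.

(** A slightly larger closed ball of radius r2 still lies in V; h is multiplied by
a cut-off that is 1 on the ball of radius r1 and 0 outside that of radius r2. *)
Lemma uc_extension n (c : 'rV[C]_n) (r : R) V (h : 'rV[C]_n -> R) : 0 < r ->
  open V -> closed_eball c r `<=` V -> (forall z, V z -> {for z, continuous h}) ->
  exists2 r1 : R, r < r1 & closed_eball c r1 `<=` V /\
    exists2 g : 'rV[C]_n -> R, uc g & forall z, closed_eball c r1 z -> g z = h z.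
Proof.
move=> r0 oV BV ch.
have [d d0 dP] := compact_thickening (compact_closed_eball (ltW r0)) oV BV.
pose N : R := (n * 2)%:R + 1; have N0 : 0 < N by rewrite ltr_wpDl.
pose r2 := r + d / N / 2.
have rr2 : r < r2 by rewrite ltrDl !divr_gt0.
have r20 : 0 < r2 by exact: lt_trans rr2.
have B2V : closed_eball c r2 `<=` V.
  move=> w wr2; pose w' := c + (r / r2)%:C *: (w - c).
  have w'r : closed_eball c r w'.
    rewrite closed_eballE ?(ltW r0) //= /w' addrKl -quad_diag quadZ quad_diag.
    rewrite exprMn mulrAC -[leRHS]mulr1 -mulrA; apply: ler_wpM2l; first exact: sqr_ge0.
    rewrite exprVn ler_pdivrMr ?exprn_gt0 // mul1r.
    by rewrite ler_sqr ?nnegrE ?eucl_norm_ge0 // ltW.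
  apply: (dP w' w'r).
  have -> : w - w' = (1 - r / r2)%:C *: (w - c).
    by rewrite /w' (rmorphB (real_complex R)) scalerBl scale1r opprD addrA.
  rewrite norm1Z ger0_norm; last by rewrite subr_ge0 ler_pdivrMr // mul1r ltW.
  apply: le_lt_trans (_ : (1 - r / r2) * (N * r2) < _).
    apply: ler_wpM2l; first by rewrite subr_ge0 ler_pdivrMr // mul1r ltW.
    apply: le_trans (norm1_le_eucl _) _; apply: ler_pM => //; first exact: eucl_norm_ge0.
    by rewrite lerDl.
  have -> : (1 - r / r2) * (N * r2) = N * (r2 - r) by field; rewrite gt_eqF.
  rewrite /r2 addrKl.
  have -> : N * (d / N / 2) = d / 2 by field; rewrite gt_eqF.
  by rewrite gtr_pMr // invf_lt1 // ltr1n.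
pose r1 := (r + r2) / 2.
have rr1 : r < r1 by rewrite midf_lt.
have r12 : r1 < r2 by rewrite midf_lt.
have r10 : 0 < r1 by exact: lt_trans rr1.
have gap : 0 < r2 ^+ 2 - r1 ^+ 2 by rewrite subr_gt0 ltr_sqr ?nnegrE ?(ltW r10) ?(ltW r20).
exists r1 => //; split.
  by move=> w wr1; apply: B2V; apply: le_trans wr1 (ltW r12).
pose chi w : R := Order.max 0 (Order.min 1 ((r2 ^+ 2 - eucl_norm (w - c) ^+ 2) / (r2 ^+ 2 - r1 ^+ 2))).
have chi1 w : closed_eball c r1 w -> chi w = 1.
  rewrite closed_eballE ?(ltW r10) //= => wr1.
  rewrite /chi; have -> : Order.min 1 ((r2 ^+ 2 - eucl_norm (w - c) ^+ 2) / (r2 ^+ 2 - r1 ^+ 2)) = 1.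
    apply/min_idPl; rewrite ler_pdivlMr // mul1r; lra.
  by apply/max_idPr; exact: ler01.
have chi0 w : r2 ^+ 2 <= eucl_norm (w - c) ^+ 2 -> chi w = 0.
  move=> wr2; rewrite /chi; apply/max_idPl; rewrite ge_min; apply/orP; right.
  by rewrite pmulr_lle0 ?invr_gt0 // subr_le0.
have cchi w : {for w, continuous chi}.
  apply: continuous_max; first exact: cst_continuous.
  apply: continuous_min; first exact: cst_continuous.
  apply: continuousM; last exact: cst_continuous.
  apply: continuousB; first exact: cst_continuous.
  exact: continuous_sqdist.
exists (fun w => chi w * h w); last by move=> w /chi1 ->; rewrite mul1r.
apply: (uc_compact_support (@compact_closed_eball n c r2 (ltW r20))).
  move=> w; have [Vw|nVw] := pselect (V w).
    by apply: continuousM; [exact: cchi|exact: ch].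
  have wr2 : r2 ^+ 2 < eucl_norm (w - c) ^+ 2.
    rewrite ltNge; apply/negP => wr; apply/nVw/B2V.
    by rewrite closed_eballE // ltW.
  apply/continuous_norm1P => e e0.
  have [|s s0 sP] := iffLR (continuous_norm1P _ w) (@continuous_sqdist n c w)
     (eucl_norm (w - c) ^+ 2 - r2 ^+ 2); first by rewrite subr_gt0.
  exists s => // y /sP; rewrite ltr_norml => /andP[H _].
  by rewrite !chi0 ?mul0r ?subrr ?normr0 //; lra.
move=> w; rewrite closed_eballE ?(ltW r20) //= => /negP; rewrite -ltNge => /ltW wr2.
by rewrite chi0 ?mul0r.
Qed.

End Converse.

(** * Tubes around a slice *)
Section Tube.
Context {R : realType} {m n : nat}.
Local Notation C := R[i].
Context (a : 'rV[C]_n) (A : 'M[C]_(m, n)) (uA : A \is unitarymx).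

(** A point z is a + proj z *m A + nrm z: the orthogonal projection to the slice, in
the coordinates of the slice, and the component normal to it. *)
Definition proj (z : 'rV[C]_n) : 'rV[C]_m := (z - a) *m A^t*.
Definition nrm (z : 'rV[C]_n) : 'rV[C]_n := z - a - proj z *m A.

Lemma projD z x : proj (z + x *m A) = proj z + x.
Proof. by rewrite /proj addrAC mulmxDl (mulmxtVK _ uA). Qed.

Lemma nrmD z x : nrm (z + x *m A) = nrm z.
Proof. by rewrite /nrm projD mulmxDl opprD addrA [z + _ - a]addrAC -!addrA; congr (_ + (_ + _));
  rewrite addrCA subrr addr0. Qed.

Lemma proj_slice w : proj (a + w *m A) = w.
Proof. by rewrite projD /proj subrr mul0mx add0r. Qed.

Lemma nrm_slice w : nrm (a + w *m A) = 0.
Proof. by rewrite nrmD /nrm /proj subrr !mul0mx subrr. Qed.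

Lemma nrmE z : z - (a + proj z *m A) = nrm z.
Proof. by rewrite /nrm opprD addrA. Qed.

Lemma proj_lipschitz : exists2 c : R, 0 < c &
  forall z w, norm1 (proj z - proj w) <= c * norm1 (z - w).
Proof.
have [c c0 cA] := norm1_mulmx_bound (A^t*); exists c => // z w.
rewrite /proj -mulmxBl; have -> : z - a - (w - a) = z - w by rewrite opprB addrA subrK.
exact: cA.
Qed.

Lemma nrm_lipschitz : exists2 c : R, 0 < c &
  forall z w, norm1 (nrm z - nrm w) <= c * norm1 (z - w).
Proof.
have [c c0 cP] := proj_lipschitz; have [d d0 dA] := norm1_mulmx_bound A.
exists (1 + d * c); first by rewrite ltr_wpDr // mulr_ge0 // ltW.
move=> z w; have -> : nrm z - nrm w = (z - w) - (proj z - proj w) *m A.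
  rewrite /nrm mulmxBl; move: (proj z *m A) (proj w *m A) => x y.
  by apply/rowP => k; rewrite !mxE; ring.
apply: le_trans (norm1D _ _) _; rewrite norm1N mulrDl mul1r lerD2l.
apply: le_trans (dA _) _; rewrite -mulrA; apply: ler_wpM2l; first exact: ltW.
exact: cP.
Qed.

Lemma uc_lipschitz p q (T : 'rV[C]_p -> 'rV[C]_q) (f : 'rV[C]_q -> R) :
  (exists2 c : R, 0 < c & forall z w, norm1 (T z - T w) <= c * norm1 (z - w)) ->
  uc f -> uc (fun z => f (T z)).
Proof.
move=> [c c0 cT] uf e /uf[d d0 dP]; exists (d / c); first by rewrite divr_gt0.
move=> z w zw; apply: dP; apply: le_trans (cT _ _) _.
by rewrite mulrC -ler_pdivlMr.
Qed.

Lemma uc_norm1 p : uc (@norm1 R p).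
Proof.
move=> e e0; exists e => // z w wz; apply: le_trans wz; rewrite ler_distl.
have h1 := norm1D (w - z) z; have h2 := norm1D (z - w) w; rewrite !subrK in h1 h2.
by rewrite (norm1_distC z w) in h2; apply/andP; split; lra.
Qed.

(** Moving z in the direction of the slice does not change the penalty, so it does
not affect mean values over circles in that direction. *)
Definition penalized (g : 'rV[C]_m -> R) (K : R) z : R := g (proj z) + (- K) * norm1 (nrm z).

Lemma penalized_uc g K : uc g -> uc (penalized g K).
Proof.
move=> ug; apply: ucD; first exact: uc_lipschitz proj_lipschitz ug.
by apply: ucZ; exact: uc_lipschitz nrm_lipschitz (@uc_norm1 n).
Qed.

Definition tube c r de : set 'rV[C]_n :=
  [set z | closed_eball c r (proj z) /\ norm1 (nrm z) <= de].

Lemma continuous_sqdist_proj c z : {for z, continuous (fun w => eucl_norm (proj w - c) ^+ 2)}.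
Proof.
have [k k0 kP] := proj_lipschitz; apply/continuous_norm1P => e e0.
have [d d0 dP] := iffLR (continuous_norm1P _ (proj z)) (@continuous_sqdist R _ c (proj z)) e e0.
exists (d / k); first by rewrite divr_gt0.
move=> w wz; apply: dP; apply: le_lt_trans (kP _ _) _.
by rewrite mulrC -ltr_pdivlMr.
Qed.

Lemma uc_norm1_nrm : uc (fun z => norm1 (nrm z)).
Proof. exact: uc_lipschitz nrm_lipschitz (@uc_norm1 n). Qed.

Lemma tube_compact c r de : 0 <= r -> compact (tube c r de).
Proof.
move=> r0; have -> : tube c r de =
    [set z | Order.max (eucl_norm (proj z - c) ^+ 2 - r ^+ 2) (norm1 (nrm z) - de) <= 0].
  rewrite /tube closed_eballE //; apply/seteqP.
  by split=> z /=; rewrite ge_max !subr_le0; [case=> -> -> | case/andP].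
have [k k0 kA] := norm1_mulmx_bound A.
apply: (@compact_sublevel _ _ _ _ (de + (norm1 a + k * ((m * 2)%:R * r + norm1 c)))).
  move=> z; apply: continuous_max.
    by apply: continuousB; [exact: continuous_sqdist_proj | exact: cst_continuous].
  by apply: continuousB; [exact/uc_continuous/uc_norm1_nrm | exact: cst_continuous].
move=> z; rewrite ge_max !subr_le0 ler_sqr ?nnegrE ?eucl_norm_ge0 // => /andP[Bz nz].
rewrite -[z in norm1 z](subrK (a + proj z *m A)); apply: le_trans (norm1D _ _) _.
rewrite nrmE; apply: lerD => //; apply: le_trans (norm1D _ _) _; rewrite lerD2l.
by apply: le_trans (kA _) _; apply: ler_wpM2l; [exact: ltW | exact: norm1_eball].
Qed.

Lemma tube_interior c r de p : 0 <= r -> eucl_norm (proj p - c) < r -> norm1 (nrm p) < de ->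
  exists2 d : R, 0 < d & forall z, norm1 (z - p) < d -> tube c r de z.
Proof.
move=> r0 pr pde.
have sq0 : 0 < r ^+ 2 - eucl_norm (proj p - c) ^+ 2.
  by rewrite subr_gt0 ltr_sqr ?nnegrE ?eucl_norm_ge0.
have [d1 d10 D1] :=
  iffLR (continuous_norm1P _ p) (@continuous_sqdist_proj c p) _ sq0.
have de0 : 0 < de - norm1 (nrm p) by rewrite subr_gt0.
have [d2 d20 D2] := iffLR (continuous_norm1P _ p) (@uc_continuous R n _ p uc_norm1_nrm) _ de0.
exists (Order.min d1 d2); first by rewrite lt_min d10.
move=> z; rewrite lt_min => /andP[z1 z2]; split.
  have := ltr_normlW (D1 z z1); rewrite ltrD2r => /ltW.
  by rewrite ler_sqr ?nnegrE ?eucl_norm_ge0.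
have := ltr_normlW (D2 z z2); rewrite ltrD2r; exact: ltW.
Qed.

(** The mean of eps |w - c|^2 over a circle of radius vector b exceeds its value at
the centre by eps |b|^2, which gives the strictness. *)
Lemma penalized_submean (V : set 'rV[C]_m) (h g : 'rV[C]_m -> R) c (r1 eps K : R) z b :
  (forall w, V w -> {for w, continuous h}) -> plurisubharmonic V (EFin \o h) ->
  closed_eball c r1 `<=` V ->
  (forall w, closed_eball c r1 w -> g w = h w + eps * eucl_norm (w - c) ^+ 2) ->
  (forall x : C, `|x| <= 1 -> closed_eball c r1 (proj z + x *: b)) ->
  penalized g K z + eps * eucl_norm b ^+ 2 <=
    average (2 * pi) (circle (b *m A)) (penalized g K) z.
Proof.
move=> ch [_ psh] BV gE zb; set w1 := proj z in zb *.
have ball0 : closed_eball c r1 w1.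
  by have := zb 0; rewrite normr0 ler01 scale0r addr0; exact.
have ballt t : closed_eball c r1 (w1 + circle b t) by exact/zb/normc_expi.
have cont : continuous (fun t => h (w1 + circle b t)).
  apply: continuous_along_at; first exact: lipschitz_circle.
  by move=> t; apply/ch/BV.
have hsub : h w1 <= mean (2 * pi) (fun t => h (w1 + circle b t)).
  by rewrite -lee_fin -(mean_integral _ cont); apply: psh => x /zb/BV.
pose k0 := (- K) * norm1 (nrm z).
pose mm (i j : 'I_m * bool) := eps * diag_quad i j + 0 * diag_quad i j.
have mmE y : quad mm y = eps * eucl_norm y ^+ 2.
  by rewrite quad_lin quad_diag mul0r addr0.
have l0 y : lin (fun=> 0) y = 0 :> R by rewrite /lin big1 // => j _; rewrite mulr0.
have E : average (2 * pi) (circle (b *m A)) (penalized g K) z =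
   mean (2 * pi) (fun t => h (w1 + circle b t) +
      (k0 + lin (fun=> 0) (w1 - c + circle b t) + quad mm (w1 - c + circle b t))).
  apply: eq_mean => t; have -> : circle (b *m A) t = circle b t *m A by rewrite /circle scalemxAl.
  rewrite /penalized projD nrmD gE; last exact: ballt.
  have -> : w1 - c + circle b t = w1 + circle b t - c by rewrite addrAC.
  by rewrite l0 mmE -/w1 addr0 -/k0; move: (eps * _) (h _) => s1 s2; ring.
rewrite E meanD; [|exact: cont|exact: continuous_quad_circle].
rewrite mean_quad_circle l0 !mmE eucl_norm_iunit.
rewrite /penalized -/w1 -/k0 gE //.
by move: hsub; set M := mean _ _; move: (eucl_norm _ ^+ 2) (eucl_norm b ^+ 2) => *; lra.
Qed.

End Tube.

Section SliceThickening.
Context {R : realType} {m n : nat}.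
Local Notation C := R[i].

Lemma slice_thickening (a : 'rV[C]_n) (A : 'M[C]_(m, n)) (K : set 'rV[C]_m) (O : set 'rV[C]_n) :
  compact K -> open O -> (forall w, K w -> O (a + w *m A)) ->
  exists2 d : R, 0 < d & forall w, K w -> forall z, norm1 (z - (a + w *m A)) < d -> O z.
Proof.
move=> cK /open_norm1P oO KO; have [k k0 kA] := norm1_mulmx_bound A.
apply: (compact_uniform (P := fun d w => forall z, norm1 (z - (a + w *m A)) < d -> O z)) => //.
move=> w /KO/oO[d d0 dP]; exists (Order.min (d / 2) (d / 2 / k)).
  by rewrite lt_min !divr_gt0.
move=> e y /andP[e0]; rewrite lt_min => /andP[ed _] _; rewrite lt_min => /andP[_ yw] z zy.
apply: dP; apply: le_lt_trans (norm1_triangle (a + y *m A) _ _) _.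
rewrite [ltRHS]splitr; apply: ltrD; first exact: lt_trans zy ed.
rewrite opprD addrACA subrr add0r -mulmxBl; apply: le_lt_trans (kA _) _.
by rewrite mulrC -ltr_pdivlMr.
Qed.

End SliceThickening.

(** * From viscosity to q-plurisubharmonic *)
Section Touching.
Context {R : realType}.
Local Notation C := R[i].

Lemma usc_slice m n (a : 'rV[C]_n) (A : 'M[C]_(m, n)) (U : set 'rV[C]_n) u :
  usc_on U u -> usc_on [set w | U (a + w *m A)] (fun w => u (a + w *m A)).
Proof.
move=> uu w Uw; have [k k0 kA] := norm1_mulmx_bound A.
have [uoo ua] := usc_norm1P uu Uw; split=> // x /ua[d d0 dP].
apply/nbhs_norm1P; exists (d / k); first by rewrite divr_gt0.
move=> y yw Uy; apply: dP => //; rewrite opprD addrACA subrr add0r -mulmxBl.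
by apply: le_lt_trans (kA _) _; rewrite mulrC -ltr_pdivlMr.
Qed.

Lemma ereal_gap (x y : \bar R) : (x < y)%E -> (y < +oo)%E ->
  exists m1 m2 : R, [/\ m1 < m2, (x < m1%:E)%E & (m2%:E < y)%E].
Proof.
case: y => [y| |] //; last by rewrite ltNge leNye.
case: x => [x| |] // xy _; last first.
  by exists (y - 2), (y - 1); rewrite ltNyr !lte_fin; split=> //; lra.
rewrite lte_fin in xy.
by exists ((2 * x + y) / 3), ((x + 2 * y) / 3); rewrite !lte_fin; split; lra.
Qed.

(** The right-hand side is written so that the linearity of quad applies to it. *)
Lemma hess_opp_near n (F G : 'rV[C]_n -> R) p (d : R) : Ck 2 setT G -> 0 < d ->
  (forall w, norm1 (w - p) < d -> F w = 0) ->
  hess (fun z => F z + (-1) * G z) p = fun i j => (-1) * hess G p i j + 0 * hess G p i j.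
Proof.
move=> kG d0 Fd; pose W := [set w : 'rV[C]_n | norm1 (w - p) < d].
have oW : open W.
  apply/open_norm1P => w /= wd; exists (d - norm1 (w - p)); first by rewrite subr_gt0.
  move=> y; rewrite ltrBrDr; apply: le_lt_trans; exact: norm1_triangle.
have Wp : W p by rewrite /W /= subrr norm10.
have /CkSP[_ dG kdG] := kG.
have W1 j w : W w -> rderiv (cdir j) (fun z => F z + (-1) * G z) w = -1 * rderiv (cdir j) G w.
  move=> wd; apply/rderivE.
  apply: (is_rderiv_local oW wd _ (is_rderivZ (-1) (dG j w I))) => y yd.
  by rewrite Fd // add0r.
apply/funext => i; apply/funext => j; rewrite mul0r addr0; apply/rderivE.
have /CkSP[_ ddG _] := kdG j.
apply: (is_rderiv_local oW Wp _ (is_rderivZ (-1) (ddG i p I))) => y yd.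
by rewrite W1.
Qed.

Lemma eucl_norm_gt0 n (b : 'rV[C]_n) : b != 0 -> 0 < eucl_norm b.
Proof.
move=> b0; rewrite lt_neqAle eucl_norm_ge0 andbT eq_sym.
apply: contra_neq b0 => eb; apply: norm1_eq0.
apply/eqP; rewrite eq_le norm1_ge0 andbT; apply: le_trans (norm1_le_eucl _) _.
by rewrite eb mulr0.
Qed.

(** The domination lemma turns a local maximum of u + G at p into a global maximum
of u - (F - G), where F vanishes near p. If the Levi form of G were positive on the
row space of A, the complex Hessian of F - G would have more than q negative
eigenvalues. *)
Lemma viscosity_touching q n (U : set 'rV[C]_n) u (A : 'M[C]_(q.+1, n)) G p (x ta : R) :
  open U -> usc_on U u ->
  (forall phi : 'rV[C]_n -> R, Ck 2 U phi -> forall p, U p ->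
    (forall z, U z -> (u z - (phi z)%:E <= u p - (phi p)%:E)%E) ->
    (ominus (complex_hessian phi p) <= q)%N) ->
  Ck 2 setT G -> uc G -> U p -> u p = x%:E -> 0 < ta ->
  (forall z, U z -> norm1 (z - p) < ta -> (u z + (G z)%:E <= (x + G p)%:E)%E) ->
  exists2 b : 'rV[C]_q.+1, b != 0 &
    quad (hess G p) (b *m A) + quad (hess G p) (iunit *: (b *m A)) <= 0.
Proof.
move=> oU uu visc kG uG Up upE ta0 vM.
have uv : usc_on U (fun z => u z + (G z)%:E)%E.
  by apply: usc_onD => // z _; exact: uc_continuous.
have [F [kF F0 [d d0 Fd] Fdom]] := domination oU Up ta0 uv vM.
have Fp : F p = 0 by apply: Fd; rewrite subrr norm10.
pose phi z := F z + (-1) * G z.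
have kphi : Ck 2 U phi.
  exact: (CkD oU kF (CkZ (-1) oU (Ck_open_subset (@subsetT _ U) kG))).
have phimax z : U z -> (u z - (phi z)%:E <= u p - (phi p)%:E)%E.
  move=> Uz; rewrite upE /phi Fp; have [zoo _] := uu z Uz; have := Fdom z Uz.
  case: (u z) zoo => [y| |] // _; last by move=> _; rewrite /= leNye.
  rewrite -!EFinB -EFinD !lee_fin; clear; move: (F z) (G z) (G p) => *; lra.
apply: contrapT => nob.
have := visc phi kphi p Up phimax; apply/negP; rewrite -ltnNge.
have hH : complex_hessian phi p \is hermsymmx.
  rewrite (complex_hessianE oU kphi Up); apply: levi_mx_herm => i j; exact: clairaut Up.
apply: (ominus_gt_of_negative hH (A := A)) => b b0.
rewrite (complex_hessianE oU kphi Up) herm_form_levi (hess_opp_near kG d0 Fd) !quad_lin.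
suff : 0 < quad (hess G p) (b *m A) + quad (hess G p) (iunit *: (b *m A)).
  by clear; move: (quad _ _) (quad _ _) => *; lra.
by rewrite ltNge; apply/negP => nb; apply: nob; exists b.
Qed.

(** On the compact sphere in the slice, u + g < M extends to a neighbourhood in C^n
by upper semicontinuity. *)
Lemma tube_radius q n (U : set 'rV[C]_n) u (a : 'rV[C]_n) (A : 'M[C]_(q, n)) g c (r M : R) :
  A \is unitarymx -> open U -> usc_on U u -> 0 < r -> uc g ->
  (forall w, closed_eball c r w -> U (a + w *m A)) ->
  (forall w, esphere c r w -> (u (a + w *m A)%R + (g w)%:E < M%:E)%E) ->
  exists2 de : R, 0 < de & tube a A c r de `<=` U /\
    forall z, tube a A c r de z -> esphere c r (proj a A z) ->
      (u z + (g (proj a A z))%:E < M%:E)%E.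
Proof.
move=> uA oU uu r0 ug BU gM.
have ugp : uc (fun z => g (proj a A z)) by exact: uc_lipschitz (proj_lipschitz a A) ug.
have uf1 : usc_on U (fun z => u z + (g (proj a A z))%:E)%E.
  by apply: usc_onD => // z _; exact: uc_continuous.
pose O := [set z | U z /\ (u z + (g (proj a A z))%:E < M%:E)%E].
have oO : open O.
  apply/open_norm1P => z [Uz fz].
  have [d d0 dP] := (iffLR (open_norm1P U) oU) z Uz.
  have [_ /(_ _ fz)[d' d'0 dP']] := usc_norm1P uf1 Uz.
  exists (Order.min d d'); first by rewrite lt_min d0.
  by move=> w; rewrite lt_min => /andP[/dP Uw /(dP' w Uw)].
have SO w : esphere c r w -> O (a + w *m A).
  move=> Sw; split; last by rewrite (proj_slice a uA); exact: gM.
  by apply: BU; move: Sw; rewrite /esphere /closed_eball /= => ->.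
have [d1 d10 D1] := slice_thickening (@compact_esphere R q c r (ltW r0)) oO SO.
have [d2 d20 D2] := slice_thickening (@compact_closed_eball R q c r (ltW r0)) oU BU.
have m0 : 0 < Order.min d1 d2 by rewrite lt_min d10.
have md : Order.min d1 d2 / 2 < Order.min d1 d2 by rewrite gtr_pMr // invf_lt1 // ltr1n.
exists (Order.min d1 d2 / 2); first by rewrite divr_gt0.
split=> [z [Bz nz]|z [Bz nz] Sz].
  apply: (D2 _ Bz); rewrite nrmE; apply: le_lt_trans nz (lt_le_trans md _).
  by rewrite ge_min lexx orbT.
have [] // : O z; apply: (D1 _ Sz); rewrite nrmE; apply: le_lt_trans nz (lt_le_trans md _).
by rewrite ge_min lexx.
Qed.

(** On the part of the boundary of the tube over the sphere, u + G is below
m1 + 2 gap by the choice of the tube; on the part at distance de from the slice, it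
is at most m1 + gap by the choice of K; but it exceeds m1 + 3 gap at w0. So the
maximum is reached in the interior. *)
Lemma smooth_tube_max q n (U : set 'rV[C]_n) u (a : 'rV[C]_n) (A : 'M[C]_(q, n)) g c
    (r de m1 gap K rho : R) w0 :
  A \is unitarymx -> usc_on U u -> 0 < r -> 0 < de -> 0 < gap -> 0 < rho -> uc g ->
  tube a A c r de `<=` U ->
  (forall z, tube a A c r de z -> esphere c r (proj a A z) ->
      (u z + (g (proj a A z))%:E < (m1 + gap)%:E)%E) ->
  0 <= K ->
  (forall z, tube a A c r de z -> (u z + (g (proj a A z))%:E <= (m1 + K * de)%:E)%E) ->
  (forall z, `|smooth rho (penalized a A g K) z - penalized a A g K z| <= gap) ->
  closed_eball c r w0 -> ((m1 + 4 * gap)%:E < u (a + w0 *m A)%R + (g w0)%:E)%E ->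
  let G := smooth rho (penalized a A g K) in
  exists p, [/\ tube a A c r de p, eucl_norm (proj a A p - c) < r, norm1 (nrm a A p) < de,
    u p \is a fin_num &
    forall z, tube a A c r de z -> (u z + (G z)%:E <= u p + (G p)%:E)%E].
Proof.
move=> uA uu r0 de0 gap0 rho0 ug TU Sg K0 Kg Gg Bw0 w0g G.
have uG : uc G by apply: smooth_uc => //; exact: penalized_uc.
have uv : usc_on U (fun z => u z + (G z)%:E)%E.
  by apply: usc_onD => // z _; exact: uc_continuous.
have T0 : tube a A c r de (a + w0 *m A).
  by rewrite /tube /= (proj_slice a uA) (nrm_slice a uA) norm10; split=> //; exact: ltW.
have [p Tp pmax] := usc_max (@tube_compact _ _ _ a A c r de (ltW r0))
  (ex_intro _ _ T0) (usc_onS TU uv).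
have vp : ((m1 + 3 * gap)%:E < u p + (G p)%:E)%E.
  apply: lt_le_trans (pmax _ T0).
  have G0 : g w0 - gap <= G (a + w0 *m A).
    have := Gg (a + w0 *m A); rewrite ler_distl => /andP[+ _].
    by rewrite /penalized (proj_slice a uA) (nrm_slice a uA) norm10 mulr0 addr0.
  apply: lt_le_trans (_ : (u (a + w0 *m A)%R + (g w0 - gap)%:E)%E <= _)%E; last first.
    by rewrite leeD2l // lee_fin.
  rewrite EFinB addeA lteBrDr // -EFinD; apply: le_lt_trans w0g.
  by rewrite lee_fin; clear; lra.
have vH : (u p + (G p)%:E <=
    u p + (g (proj a A p))%:E + (gap - K * norm1 (nrm a A p))%:E)%E.
  rewrite -addeA -EFinD leeD2l // lee_fin.
  have := Gg p; rewrite ler_distl => /andP[_]; rewrite /penalized -/G.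
  by clear; move: (G p) (g _) (norm1 _) => *; lra.
have := lt_le_trans vp vH; have [Bp np] := Tp => pE.
exists p; split=> //.
- rewrite lt_neqAle Bp andbT; apply/negP => /eqP rp; move: pE (Sg p Tp rp).
  case: (u p + (g _)%:E)%E => [y| |] //; rewrite -EFinD !lte_fin.
  have := mulr_ge0 K0 (norm1_ge0 (nrm a A p)).
  by clear -gap0; move: (K * _) => *; lra.
- rewrite lt_neqAle np andbT; apply/negP => /eqP nE; move: pE (Kg p Tp); rewrite nE.
  case: (u p + (g _)%:E)%E => [y| |] //; rewrite -EFinD lte_fin lee_fin.
  by clear -gap0; move: (K * _) => *; lra.
- by move: vp (uu p (TU p Tp)).1; case: (u p).
Qed.

(** The margin m2 - m1 = 4 gap by which the maximum principle fails pays for adding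
eps |w - c|^2 (one gap on the sphere) and for smoothing (one gap up or down). *)
Theorem viscosity_qpsh_qpsh q n (U : set 'rV[C]_n) u : open U -> usc_on U u ->
  viscosity_qpsh q U u -> qpsh q U u.
Proof.
move=> oU uu [inf|visc] qn a A uA; first by left=> w /inf.
right=> c r r0 BU V h oV BV ch pshh; apply: contrapT => nmax.
have SB : esphere c r `<=` closed_eball c r by move=> w; rewrite /esphere /closed_eball /= => ->.
have uf : usc_on (closed_eball c r) (fun w => u (a + w *m A)%R + (h w)%:E)%E.
  apply: (usc_onD (usc_onS BU (@usc_slice _ _ a A U u uu))).
  by move=> w /BV/ch.
have [z1 Sz1 z1max] := usc_max (@compact_esphere R q.+1 c r (ltW r0))
  (@esphere_nonempty R q c r (ltW r0)) (usc_onS SB uf).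
have [w0 Bw0 w0gt] : exists2 w0, closed_eball c r w0 &
    (u (a + z1 *m A)%R + (h z1)%:E < u (a + w0 *m A)%R + (h w0)%:E)%E.
  apply: contrapT => no; apply: nmax; exists z1 => // w Bw; rewrite leNgt; apply/negP => lt.
  by apply: no; exists w.
have [m1 [m2 [m12 z1m1 m2w0]]] := ereal_gap w0gt (uf w0 Bw0).1.
pose gap := (m2 - m1) / 4; have gap0 : 0 < gap by rewrite divr_gt0 // subr_gt0.
have m2E : m2 = m1 + 4 * gap by rewrite /gap; field.
pose eps := gap / r ^+ 2; have eps0 : 0 < eps by rewrite divr_gt0 // exprn_gt0.
have ch1 w : V w -> {for w, continuous (fun w => h w + eps * eucl_norm (w - c) ^+ 2)}.
  move=> Vw; apply: continuousD; first exact: ch.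
  by apply: continuousM; [exact: cst_continuous | exact: continuous_sqdist].
have [r1 rr1 [B1V [g ug gE]]] := uc_extension r0 oV BV ch1.
have BB1 w : closed_eball c r w -> closed_eball c r1 w by move=> wr; apply: le_trans wr (ltW rr1).
have Sg w : esphere c r w -> (u (a + w *m A)%R + (g w)%:E < (m1 + gap)%:E)%E.
  move=> Sw; rewrite gE; last exact/BB1/SB.
  rewrite Sw /eps divfK ?expf_neq0 ?gt_eqF // !EFinD addeA lteD2rE //.
  exact: le_lt_trans (z1max w Sw) z1m1.
have [de de0 [TU TS]] := tube_radius uA oU uu r0 ug BU Sg.
have uf1 : usc_on U (fun z => u z + (g (proj a A z))%:E)%E.
  apply: usc_onD => // z _; apply: uc_continuous.
  exact: uc_lipschitz (proj_lipschitz a A) ug.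
have [M0 M0P] := usc_bounded (@tube_compact _ _ _ a A c r de (ltW r0)) (usc_onS TU uf1).
(* With this K, the penalty at distance de from the slice is at least M0 - m1. *)
pose K := Order.max 0 (M0 - m1) / de.
have K0 : 0 <= K by rewrite divr_ge0 ?le_max ?lexx // ltW.
have KM z : tube a A c r de z -> (u z + (g (proj a A z))%:E <= (m1 + K * de)%:E)%E.
  move=> /M0P/le_trans; apply; rewrite lee_fin -lerBlDl.
  by rewrite /K divfK ?gt_eqF // le_max lexx orbT.
have uH : uc (penalized a A g K) by exact: penalized_uc.
have [rho0 rho00 rhoP] := smooth_close uH gap0.
have B1o : open [set w : 'rV[C]_q.+1 | eucl_norm (w - c) ^+ 2 < r1 ^+ 2].
  apply/open_norm1P => w /= wr.
  have [|d d0 dP] := iffLR (continuous_norm1P _ w) (@continuous_sqdist R _ c w)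
     (r1 ^+ 2 - eucl_norm (w - c) ^+ 2); first by rewrite subr_gt0.
  by exists d => // y /dP; rewrite ltr_norml => /andP[_]; rewrite ltrD2r.
have r10 : 0 < r1 by exact: lt_trans rr1.
have BB1o w : closed_eball c r w -> eucl_norm (w - c) ^+ 2 < r1 ^+ 2.
  move=> wr; rewrite ltr_sqr ?nnegrE ?eucl_norm_ge0 ?(ltW r10) //.
  exact: le_lt_trans wr rr1.
have [d3 d30 D3] := compact_thickening (@compact_closed_eball R q.+1 c r (ltW r0)) B1o BB1o.
have [cp cp0 cpP] := proj_lipschitz a A.
pose rho := Order.min rho0 (d3 / 2 / cp).
have rhogt0 : 0 < rho by rewrite lt_min rho00 !divr_gt0.
have Gg z : `|smooth rho (penalized a A g K) z - penalized a A g K z| <= gap.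
  by apply: rhoP; rewrite rhogt0 ge_min lexx.
have w0g : ((m1 + 4 * gap)%:E < u (a + w0 *m A)%R + (g w0)%:E)%E.
  rewrite -m2E; apply: lt_le_trans m2w0 _; rewrite leeD2l // lee_fin gE; last exact: BB1.
  by rewrite lerDl mulr_ge0 ?sqr_ge0 ?(ltW eps0).
have [p [Tp rp np upfin pmax]] :=
  smooth_tube_max uA uu r0 de0 gap0 rhogt0 ug TU TS K0 KM Gg Bw0 w0g.
have [ta ta0 taT] := tube_interior (ltW r0) rp np.
set G := smooth rho _ in pmax.
have kG : Ck 2 setT G by exact: Ck2_smooth.
have uG : uc G by exact: smooth_uc.
have upE : u p = (fine (u p))%:E by rewrite fineK.
have vM z : U z -> norm1 (z - p) < ta -> (u z + (G z)%:E <= (fine (u p) + G p)%:E)%E.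
  by move=> _ /taT/pmax; rewrite EFinD -upE.
have [b b0] := viscosity_touching A oU uu visc kG uG (TU p Tp) upE ta0 vM.
apply/negP; rewrite -ltNge.
have eb : 0 < eucl_norm b ^+ 2 by rewrite exprn_gt0 // eucl_norm_gt0.
pose be := norm1 b + norm1 (iunit *: b) + 1.
have be0 : 0 < be by rewrite ltr_wpDl // addr_ge0 ?norm1_ge0.
apply: (@levi_of_submean _ _ G p _ (eps * eucl_norm b ^+ 2) (d3 / 2 / be)) => //.
- exact: mulr_gt0.
- by rewrite !divr_gt0.
move=> s /andP[s0 sd]; rewrite scalemxAl.
apply: smooth_submean => //; [exact: two_pi_gt0 | exact: lipschitz_circle |].
move=> w wp.
have -> : eps * eucl_norm b ^+ 2 * s ^+ 2 = eps * eucl_norm (s%:C *: b) ^+ 2.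
  by rewrite -!quad_diag quadZ mulrAC mulrA.
apply: (@penalized_submean R q.+1 n a A uA V h g c r1 eps K w (s%:C *: b) ch pshh B1V gE) => y y1.
rewrite closed_eballE ?(ltW r10) //=; apply: ltW; apply: (D3 (proj a A p)); first by case: Tp.
have -> : proj a A w + y *: (s%:C *: b) - proj a A p =
    (proj a A w - proj a A p) + y *: (s%:C *: b) by rewrite addrAC.
apply: le_lt_trans (norm1D _ _) _; rewrite [ltRHS]splitr; apply: ler_ltD.
  apply: le_trans (cpP _ _) _; apply: le_trans (_ : cp * (d3 / 2 / cp) <= _).
    apply: ler_wpM2l; first exact: ltW.
    by apply: le_trans wp _; rewrite ge_min lexx orbT.
  by rewrite mulrC divfK ?gt_eqF.
apply: le_lt_trans (norm1_disc _ y1) _.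
rewrite scale_iunitC !norm1Z (ger0_norm (ltW s0)) -mulrDr.
apply: le_lt_trans (_ : s * be < _); last by rewrite -ltr_pdivlMr.
by apply: ler_wpM2l; [exact: ltW | rewrite lerDl].
Qed.

End Touching.

Theorem theorem2p10 (R : realType) (q n : nat)
    (U : set 'rV[R[i]]_n) (u : 'rV[R[i]]_n -> \bar R) :
  open U -> U !=set0 -> usc_on U u ->
  (qpsh q U u <-> viscosity_qpsh q U u).
Proof.
move=> oU _ uu; split; first exact: qpsh_viscosity.
exact: viscosity_qpsh_qpsh.
Qed.
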